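(* Let $B$ be a one-dimensional standard Brownian motion with $B(0)=0$, let $\ell\in\mathcal{D}^-[0,\infty)$, $r\in\mathcal{D}^+[0,\infty)$ with $\ell\le r$, let $x\in\mathbb{R}$, let $W=\overline{\Gamma}_{\ell,r}(x+B)$ and $Y=W-x-B$. Let $\tau=\inf\{t>0: r(t)=\ell(t)\text{ or } r(t-)=\ell(t-)\}$ and assume $\tau\in(0,\infty)$. Let $\dot D=\{(t,y):\ell(t)<y<r(t)\}$. Suppose there is a strictly increasing sequence $\{s_k\}_{k\in\mathbb{Z}}$ with $\lim_{k\to-\infty}s_k=0$ and $\lim_{k\to\infty}s_k=\tau$, a constant $c_1<\infty$ and sequences $\{a_k\}_{k\in\mathbb{Z}}$, $\{b_k\}_{k\in\mathbb{Z}}$ such that $\{(t,y): s_k<t<s_{k+1},\ a_k<y<b_k\}\subset\dot D$ and $$(1/c_1)(s_{k+1}-s_k)^{1/2}<b_k-a_k<c_1(s_{k+1}-s_k)^{1/2}$$ for every $k\in\mathbb{Z}$. Let $m_k=(a_k+b_k)/2$, $d_k=|r(s_k)-m_k|+|\ell(s_k)-m_k|$ and $$d_k'=\big(|r(s_{k+1})-m_k|\vee|r(s_{k+1}-)-m_k|\big)+\big(|\ell(s_{k+1})-m_k|\vee|\ell(s_{k+1}-)-m_k|\big).$$ Suppose $\sum_{k\in\mathbb{Z}}(s_{k+1}-s_k)^{1/2}<\infty$, $\sum_{k\in\mathbb{Z}}d_k<\infty$ and $\sum_{k\in\mathbb{Z}}d_k'<\infty$. Then $\mathbb{E}\big[\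mathcal{V}_{[0,\tau]}Y\big]<\infty$.
   Context: $\mathcal{D}[0,\infty)$ denotes the càdlàg functions $[0,\infty)\to(-\infty,\infty)$; $\mathcal{D}^-[0,\infty)$ (resp. $\mathcal{D}^+[0,\infty)$) denotes càdlàg functions with values in $[-\infty,\infty)$ (resp. $(-\infty,\infty]$). $\mathcal{V}_{[t_1,t_2]}(f)$ is the total variation of $f$ on $[t_1,t_2]$; $a\vee b=\max\{a,b\}$. ESP: $(\phi,\eta)\in\mathcal{D}[0,\infty)^2$ solves the extended Skorokhod problem on $[\ell(\cdot),r(\cdot)]$ for $\psi\in\mathcal{D}[0,\infty)$ if (1) $\phi(t)=\psi(t)+\eta(t)\in[\ell(t),r(t)]$ for all $t\ge0$; (2) for all $0\le s\le t$: $\eta(t)-\eta(s)\ge0$ if $\phi(u)<r(u)$ for all $u\in(s,t]$, and $\eta(t)-\eta(s)\le0$ if $\phi(u)>\ell(u)$ for all $u\in(s,t]$; (3) for all $t\ge0$: $\eta(t)-\eta(t-)\ge0$ if $\phi(t)<r(t)$, and $\eta(t)-\eta(t-)\le0$ if $\phi(t)>\ell(t)$, where $\eta(0-)=0$. For $\ell\le r$ this problem has a unique solution for every $\psi$; $\overline{\Gamma}_{\ell,r}(\psi)$ denotes its first component (applied pathwise). *)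

(* Defs.v *)
From HB Require Import structures.
From mathcomp Require Import all_boot all_order all_algebra.
From mathcomp Require Import all_classical all_reals all_analysis measurable_realfun.
Set Implicit Arguments. Unset Strict Implicit. Unset Printing Implicit Defensive.
Import Order.TTheory GRing.Theory Num.Theory.
Import numFieldNormedType.Exports.
Local Open Scope classical_set_scope.
Local Open Scope ring_scope.

Section Defs.
Context {R : realType}.

Definition cadlag {X : ptopologicalType} (f : R -> X) : Prop :=
  (forall t : R, 0 <= t -> f x @[x --> t^'+] --> f t) /\
  (forall t : R, 0 < t -> cvg (f x @[x --> t^'-])).

Definition leftlim {X : ptopologicalType} (f : R -> X) (t : R) : X :=
  lim (f x @[x --> t^'-]).

Definition leftlim0 (f : R -> R) (t : R) : R :=
  if t == 0 then 0 else leftlim f t.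

(* (phi, eta) solves the extended Skorokhod problem on [l, r] for psi *)
Definition ESP (l r : R -> \bar R) (psi phi eta : R -> R) : Prop :=
  [/\ cadlag phi, cadlag eta,
   (forall t, 0 <= t -> phi t = psi t + eta t /\ (l t <= (phi t)%:E <= r t)%E),
   (forall s t, 0 <= s -> s <= t ->
      ((forall u, s < u -> u <= t -> ((phi u)%:E < r u)%E) -> eta s <= eta t) /\
      ((forall u, s < u -> u <= t -> (l u < (phi u)%:E)%E) -> eta t <= eta s)) &
   (forall t, 0 <= t ->
      (((phi t)%:E < r t)%E -> leftlim0 eta t <= eta t) /\
      ((l t < (phi t)%:E)%E -> eta t <= leftlim0 eta t))].

Context {d : measure_display} {T : measurableType d}.

Definition mutually_independent (P : probability T R) (n : nat)
    (X : 'I_n -> T -> R) : Prop :=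
  forall A : 'I_n -> set R, (forall i, measurable (A i)) ->
    P (\bigcap_(i in [set: 'I_n]) (X i @^-1` A i)) =
    (\prod_(i < n) P (X i @^-1` A i))%E.

Definition standard_brownian (P : probability T R) (B : T -> R -> R) : Prop :=
  [/\ (forall w, B w 0 = 0),
      (forall w, {within [set t : R | 0 <= t], continuous (B w)}),
      (forall t, 0 <= t -> measurable_fun [set: T] (fun w => B w t)),
      (forall s t, 0 <= s -> s < t -> forall A : set R, measurable A ->
         P ((fun w => B w t - B w s) @^-1` A) = normal_prob 0 (Num.sqrt (t - s)) A) &
      (forall (n : nat) (t : nat -> R), 0 <= t 0%N ->
         (forall i, (i < n)%N -> t i < t i.+1) ->
         mutually_independent P (fun (i : 'I_n) w => B w (t i.+1) - B w (t i)))].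

End Defs.

Section Defs2.
Context {R : realType}.

Definition collision_set (l r : R -> \bar R) : set R :=
  [set t | 0 < t /\ (r t = l t \/ leftlim r t = leftlim l t)].

Definition midpt (a b : int -> R) (k : int) : R := (a k + b k) / 2.

Definition dk (l r : R -> \bar R) (s a b : int -> R) (k : int) : \bar R :=
  (`|r (s k) - (midpt a b k)%:E| + `|l (s k) - (midpt a b k)%:E|)%E.

Definition dk' (l r : R -> \bar R) (s a b : int -> R) (k : int) : \bar R :=
  (maxe `|r (s (k + 1)%R) - (midpt a b k)%:E| `|leftlim r (s (k + 1)%R) - (midpt a b k)%:E|
 + maxe `|l (s (k + 1)%R) - (midpt a b k)%:E| `|leftlim l (s (k + 1)%R) - (midpt a b k)%:E|)%E.

End Defs2.

(* Main.v *)
Require Import Defs.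
From HB Require Import structures.
From mathcomp Require Import all_boot all_order all_algebra.
From mathcomp Require Import all_classical all_reals all_analysis measurable_realfun.
From mathcomp Require Import zify ring lra.
Import Order.TTheory GRing.Theory Num.Theory.
Import numFieldNormedType.Exports.
Local Open Scope classical_set_scope.
Local Open Scope ring_scope.
Set Implicit Arguments. Unset Strict Implicit. Unset Printing Implicit Defensive.

(** On an interval [[s_k, s_(k+1)]] no barrier enters the band [(a_k, b_k)].  So [Y] is monotone as
    long as [W] does not cross the band, and during a crossing [Y] does not help [W]: each change
    of direction costs an oscillation of the Brownian path of size [b_k - a_k].  Summing over the
    monotone runs, the variation of [Y] is at most the distances of the barriers from the midpoint
    at the two end points plus [C (h + Q / h ^ 3)], where [h] is half the width of the band and [Q]
    dominates the 4-variation of the Brownian path.  Chaining along dyadic points gives such a [Q]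
    with mean of order [(s_(k+1) - s_k) ^ 2], and as [h] is comparable to
    [(s_(k+1) - s_k) ^ (1/2)] the bounds are summable over [k].  Right continuity removes the
    accumulation point [0], and the possible jump of [Y] at [tau] is bounded by a constant. *)

(** * Chaining along dyadic points *)

(** Nothing guarantees beforehand that [eta] has bounded variation, so it cannot be split into a
    part pushed by [l] and a part pushed by [r]; the only tools are conditions (2) and (3) of [ESP],
    applied where one barrier is not met. The fourth power is dictated by chaining: level [n] has
    [2 ^ n] intervals of length proportional to [2 ^ - n], so the sum of the second moments does not
    decay in [n], whereas that of the fourth moments decays like [2 ^ - n] and leaves room for the
    convexity weights. The control has to be superadditive because it is spent on disjoint runs
    whose number depends on the path. The conclusion also contains the measurability of the
    variation, although the solution is only given path by path: right continuity reduces the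
    variation to dyadic grids, and [eta t] is compared with events that involve only countably many
    times of the Brownian path. *)

Section Chaining.
Context {R : realFieldType}.
Implicit Types (F : nat -> R) (x y : R) (N n i j k : nat).

(* Convexity with weights [1/5] and [4/5].  What matters for the sum over dyadic levels is that
   [(4/5) ^ -3 = 125/64 < 2]. *)
Lemma exp4_addr_le x y : (x + y) ^+ 4 <= 125 * x ^+ 4 + 125 / 64 * y ^+ 4.
Proof.
have sq (u v : R) : (u + v) ^+ 2 <= 5 * u ^+ 2 + 5 / 4 * v ^+ 2.
  by have := sqr_ge0 (2 * u - v / 2); lra.
have h4 (z : R) : z ^+ 4 = (z ^+ 2) ^+ 2 by rewrite -exprM.
have := sq (5 * x ^+ 2) (5 / 4 * y ^+ 2).
have : ((x + y) ^+ 2) ^+ 2 <= (5 * x ^+ 2 + 5 / 4 * y ^+ 2) ^+ 2.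
  by rewrite ler_sqr ?nnegrE ?sq ?sqr_ge0 // addr_ge0 // mulr_ge0 ?sqr_ge0//; lra.
rewrite !exprMn !h4; lra.
Qed.

Lemma exp4_sum_le (a : nat -> R) N :
  (\sum_(n < N) a n) ^+ 4 <= 125 * \sum_(n < N) (125 / 64) ^+ n * a n ^+ 4.
Proof.
elim: N a => [|N IH] a; first by rewrite !big_ord0 expr0n mulr0.
rewrite !big_ord_recl /= expr0 mul1r.
apply: le_trans (exp4_addr_le _ _) _.
have := IH (fun n => a n.+1).
have -> : \sum_(i < N) (125 / 64) ^+ (bump 0 i) * a (bump 0 i) ^+ 4 =
   125 / 64 * \sum_(n < N) (125 / 64) ^+ n * a n.+1 ^+ 4 :> R.
  by rewrite mulr_sumr; apply: eq_bigr => n _; rewrite /bump leq0n add1n exprS mulrA.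
rewrite -/(\sum_(i < N) a i.+1); lra.
Qed.

(* The points [0 .. 2 ^ N] stand for the dyadic points of level [N]; the sum is over the
   intervals of level [n <= N] contained in [[i, j]]. *)
Definition dyadic_sum F N n i j : R :=
  \sum_(0 <= k < 2 ^ n | (i <= k * 2 ^ (N - n))%N && (k.+1 * 2 ^ (N - n) <= j)%N)
    `|F (k.+1 * 2 ^ (N - n))%N - F (k * 2 ^ (N - n))%N| ^+ 4.

Lemma dyadic_sum_ge0 F N n i j : 0 <= dyadic_sum F N n i j.
Proof. by apply: sumr_ge0 => k _; rewrite exprn_ge0. Qed.

(** No interval of positive length lies both left and right of [j]; those straddling [j] are lost,
    hence only an inequality. *)
Lemma dyadic_sum_superadditive F N n i j k : (i <= j)%N -> (j <= k)%N ->
  dyadic_sum F N n i j + dyadic_sum F N n j k <= dyadic_sum F N n i k.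
Proof.
move=> ij jk; rewrite /dyadic_sum big_mkcond [X in _ + X]big_mkcond [leRHS]big_mkcond /=.
rewrite -big_split; apply: ler_sum => m _ /=.
set t := _ ^+ 4; have t0 : 0 <= t by rewrite exprn_ge0.
set p := (2 ^ _)%N; have p0 : (0 < p)%N by rewrite expn_gt0.
have h : (m * p < m.+1 * p)%N by rewrite ltn_pmul2r.
case: (leqP i (m * p)) => a1; case: (leqP (m.+1 * p) j) => a2;
  case: (leqP j (m * p)) => a3; case: (leqP (m.+1 * p) k) => a4 /=;
  rewrite ?addr0 ?add0r //; exfalso; lia.
Qed.

Lemma dyadic_sum_term F N i j k : (i <= k)%N -> (k < j)%N -> (j <= 2 ^ N)%N ->
  `|F k.+1 - F k| ^+ 4 <= dyadic_sum F N N i j.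
Proof.
move=> ik kj jN; rewrite /dyadic_sum subnn expn0 big_mkord.
have kN : (k < 2 ^ N)%N by exact: leq_trans jN.
rewrite (bigD1 (Ordinal kN)) /= ?muln1 ?ik ?kj//.
by rewrite lerDl sumr_ge0// => m _; rewrite exprn_ge0.
Qed.

Lemma dyadic_sum_double F N n i j : (n <= N)%N ->
  dyadic_sum (fun k => F k.*2) N n (uphalf i) j./2 = dyadic_sum F N.+1 n i j.
Proof.
move=> nN; rewrite /dyadic_sum subSn// expnS.
apply: eq_big => [k|k _].
  by rewrite leq_uphalf_double geq_half_double; congr (_ && _); congr leq; lia.
by congr (`|F _ - F _| ^+ 4); lia.
Qed.

(** Round [i] up and [j] down to even points. The two corrections are intervals of the finest level
    inside [[i, j]], and what remains is an increment on the grid one level coarser. Each level thus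
    contributes at most two intervals, and [(u + v) ^ 4 <= 8 * u ^ 4 + 8 * v ^ 4] gives the factor
    16. *)
Lemma chaining N F i j : (i <= j)%N -> (j <= 2 ^ N)%N -> exists a : nat -> R,
  `|F j - F i| <= \sum_(n < N.+1) a n /\
  forall n, (n <= N)%N -> a n ^+ 4 <= 16 * dyadic_sum F N n i j.
Proof.
(* The case [i = j] is separate: for odd [i], rounding inwards would make the end points pass each
   other. *)
elim: N F i j => [|N IH] F i j ij jN; (case: (ltngtP i j) => [ltij||eqij]; last 1 first).
- exists (fun _ => 0); rewrite eqij subrr normr0 sumr_ge0//; split=> // n _.
  by rewrite expr0n mulr_ge0// dyadic_sum_ge0.
- have [-> ->] : i = 0%N /\ j = 1%N by rewrite expn0 in jN; lia.
  exists (fun _ => `|F 1%N - F 0%N|); rewrite big_ord1; split => // n.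
  rewrite leqn0 => /eqP ->.
  apply: le_trans (@dyadic_sum_term F 0 0 1 0 isT isT isT) _ => //.
  by rewrite ler_peMl ?dyadic_sum_ge0// ler1n.
- by rewrite ltnNge ij.
- exists (fun _ => 0); rewrite eqij subrr normr0 sumr_ge0//; split=> // n _.
  by rewrite expr0n mulr_ge0// dyadic_sum_ge0.
- have jN2 : (j./2 <= 2 ^ N)%N by rewrite leq_half_double -mul2n -expnS; lia.
  have ij2 : (uphalf i <= j./2)%N by rewrite uphalf_half; lia.
  have [a [a1 a2]] := IH (fun k => F k.*2) _ _ ij2 jN2.
  pose e := (if odd j then `|F j.-1.+1 - F j.-1| else 0) +
            (if odd i then `|F i.+1 - F i| else 0).
  exists (fun n => if (n <= N)%N then a n else e); split.
    rewrite big_ord_recr /= ltnn.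
    under eq_bigr do rewrite -ltnS ltn_ord.
    have -> : F j - F i = (F j - F (j./2).*2) + (F (j./2).*2 - F (uphalf i).*2)
       + (F (uphalf i).*2 - F i) by ring.
    apply: le_trans (ler_normD _ _) _; rewrite /e.
    apply: le_trans (lerD (ler_normD _ _) (lexx _)) _.
    rewrite [X in X + _ <= _]addrC -addrA; apply: lerD => //.
    apply: lerD.
      case: ifPn => oj; last by rewrite even_halfK// subrr normr0.
      by rewrite odd_halfK// prednK//; lia.
    case: ifPn => oi; first by rewrite uphalf_half oi doubleD odd_halfK//= add2n prednK//; lia.
    by rewrite uphalf_half (negbTE oi) add0n even_halfK// subrr normr0.
  move=> n nN; case: ifPn => [nN'|nN']; first by rewrite -dyadic_sum_double//; exact: a2.
  have -> : n = N.+1 by lia.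
  set D := dyadic_sum _ _ _ _ _; have D0 : 0 <= D by exact: dyadic_sum_ge0.
  have e1 : (if odd j then `|F j.-1.+1 - F j.-1| else 0) ^+ 4 <= D.
    case: ifP => _; last by rewrite expr0n.
    by apply: dyadic_sum_term => //; lia.
  have e2 : (if odd i then `|F i.+1 - F i| else 0) ^+ 4 <= D.
    case: ifP => _; last by rewrite expr0n.
    by apply: dyadic_sum_term => //; lia.
  move: e1 e2; rewrite /e; set u := if _ then _ else _; set v := if _ then _ else _.
  have sq (y z : R) : (y + z) ^+ 2 <= 2 * y ^+ 2 + 2 * z ^+ 2.
    by have := sqr_ge0 (y - z); lra.
  have h4 (z : R) : z ^+ 4 = (z ^+ 2) ^+ 2 by rewrite -exprM.
  have := sq (2 * u ^+ 2) (2 * v ^+ 2).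
  have : ((u + v) ^+ 2) ^+ 2 <= (2 * u ^+ 2 + 2 * v ^+ 2) ^+ 2.
    by rewrite ler_sqr ?nnegrE ?sq ?sqr_ge0 // addr_ge0 // mulr_ge0 ?sqr_ge0//; lra.
  rewrite !exprMn !h4; lra.
- by rewrite ltnNge ij.
Qed.

(** A control in the sense of rough paths. The factor 125 and the weights come from [exp4_sum_le],
    the factor 16 from [chaining]. *)
Definition dyadic_control F N i j : R :=
  125 * 16 * \sum_(n < N.+1) (125 / 64) ^+ n * dyadic_sum F N n i j.

Lemma dyadic_control_ge0 F N i j : 0 <= dyadic_control F N i j.
Proof.
rewrite mulr_ge0 ?sumr_ge0// => n _.
by rewrite mulr_ge0 ?dyadic_sum_ge0// exprn_ge0//; lra.
Qed.

Lemma dyadic_control_superadditive F N i j k : (i <= j)%N -> (j <= k)%N ->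
  dyadic_control F N i j + dyadic_control F N j k <= dyadic_control F N i k.
Proof.
move=> ij jk; rewrite /dyadic_control -mulrDr ler_wpM2l// -big_split /=.
by apply: ler_sum => n _; rewrite -mulrDr ler_wpM2l ?dyadic_sum_superadditive// exprn_ge0.
Qed.

Lemma dyadic_controlP F N i j : (i <= j)%N -> (j <= 2 ^ N)%N ->
  `|F j - F i| ^+ 4 <= dyadic_control F N i j.
Proof.
move=> ij jN; have [a [a1 a2]] := chaining F ij jN.
apply: (@le_trans _ _ ((\sum_(n < N.+1) a n) ^+ 4)).
  by rewrite lerXn2r// nnegrE//; exact: le_trans a1.
apply: le_trans (exp4_sum_le _ _) _; rewrite /dyadic_control.
rewrite -mulrA ler_wpM2l// mulr_sumr; apply: ler_sum => n _.
rewrite [leRHS]mulrCA ler_wpM2l ?exprn_ge0//.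
by apply: a2; rewrite -ltnS.
Qed.

End Chaining.

(** * Variation of an alternating sequence *)

Section Oscillation.
Context {R : realFieldType}.

Definition sgb (s : bool) : R := if s then 1 else -1.

Lemma sgbN s : sgb (~~ s) = - sgb s.
Proof. by case: s; rewrite /sgb ?opprK. Qed.

Lemma norm_sgb s (x : R) : `|sgb s * x| = `|x|.
Proof. by case: s; rewrite /sgb ?mul1r ?mulN1r ?normrN. Qed.

(** If [h < |y|] then [|y| * h ^ 3 <= |y| ^ 4]. A bound linear in [w], instead of its fourth root,
    lets superadditivity sum the contributions of the runs. *)
Lemma le_exp4_div (h y w : R) : 0 < h -> `|y| ^+ 4 <= w -> `|y| <= h + w / h ^+ 3.
Proof.
move=> h0 yw; have [yh|yh] := leP `|y| h.
  rewrite (le_trans yh)// lerDl divr_ge0 ?exprn_ge0 ?(ltW h0)//.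
  by rewrite (le_trans _ yw)// exprn_ge0.
rewrite (@le_trans _ _ (w / h ^+ 3))// ?lerDr ?(ltW h0)//.
rewrite ler_pdivlMr ?exprn_gt0//; apply: le_trans yw.
by rewrite [leRHS]exprS ler_wpM2l// lerXn2r// ?nnegrE ltW.
Qed.

(* Along a maximal run on which [eta] is monotone, its variation is the increment of
   [phi - f]; a change of direction forces [f] to oscillate by [h], which costs [h ^ 4] of
   the control [om].  [hit s i] means that [sgb s * phi] goes below [- h] in window [i]. *)
Lemma discrete_variation_le (n : nat) (f eta : nat -> R) (h : R)
    (hit : bool -> nat -> Prop) (om : nat -> nat -> R) :
  0 < h ->
  (forall i j, 0 <= om i j) ->
  (forall i j k, (i <= j)%N -> (j <= k)%N -> om i j + om j k <= om i k) ->
  (forall i j, (i <= j)%N -> (j <= n)%N -> `|f j - f i| ^+ 4 <= om i j) ->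
  (forall s i, (i < n)%N -> ~ hit (~~ s) i ->
     sgb s * eta i <= sgb s * eta i.+1 /\ sgb s * (f i.+1 + eta i.+1) < h) ->
  (forall s i j, (j <= i)%N -> (i < n)%N -> hit s j -> hit (~~ s) i ->
     exists k, [/\ (j <= k)%N, (k <= i)%N & h <= `|f i - f k|]) ->
  \sum_(0 <= k < n) `|eta k.+1 - eta k| <=
    `|f 0%N + eta 0%N| + 2 * h + 4 * (om 0%N n / h ^+ 3).
Proof.
move=> h0 om0 omD omP mono cross.
pose K := fun i j => om i j / h ^+ 3.
have h30 : 0 < h ^+ 3 by rewrite exprn_gt0.
have K0 i j : 0 <= K i j by rewrite divr_ge0// ltW.
have KD i j k : (i <= j)%N -> (j <= k)%N -> K i j + K j k <= K i k.
  by move=> ij jk; rewrite /K -mulrDl ler_pM2r ?invr_gt0 ?omD.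
have KP i j : (i <= j)%N -> (j <= n)%N -> `|f j - f i| <= h + K i j.
  by move=> ij jn; apply: le_exp4_div => //; exact: omP.
have Kh i j : h ^+ 4 <= om i j -> h <= K i j.
  by rewrite /K ler_pdivlMr// -exprS.
rewrite -/(K 0%N n); clearbody K.
pose S i := \sum_(0 <= k < i) `|eta k.+1 - eta k|.
have SS i : S i.+1 = S i + `|eta i.+1 - eta i| by rewrite /S big_nat_recr.
set A := `|f 0%N + eta 0%N| + h.
(* Here [s] is the direction of the current run, [u] the window where the run starts (0 for the
   first run) and [j] a window where [s] is hit. As [S i - sgb s * eta i] is constant along a run,
   the bound is only updated at a change of direction. *)
pose St i := exists s u j, [/\ [/\ (u <= j)%N, (j < i)%N & hit s j],
   (forall k, (u <= k < i)%N -> ~ hit (~~ s) k) &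
   S i + h - sgb s * eta i - sgb s * f u <= A + 3 * K 0%N j + K 0%N u].
pose St0 i := (forall s k, (k < i)%N -> ~ hit s k) /\ S i = 0.
have Sabs i s : (i < n)%N -> ~ hit (~~ s) i -> S i.+1 = S i + sgb s * eta i.+1 - sgb s * eta i.
  move=> iN /(mono _ _ iN) [le1 _]; rewrite SS -(norm_sgb s) mulrBr ger0_norm ?subr_ge0//.
  by rewrite addrA.
have main i : (i <= n)%N -> St0 i \/ St i.
  elim: i => [_|i IH iN]; first by left; split => //; rewrite /S big_geq.
  (* In a single window [cross] can only return [k = i], which would give [h <= 0]. *)
  have hboth s : hit s i -> hit (~~ s) i -> False.
    move=> h1 h2; have [k [k1 k2]] := cross _ _ _ (leqnn i) iN h1 h2.
    have -> : k = i by lia.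
    by rewrite subrr normr0 leNgt h0.
  case: (IH (ltnW iN)) => [[nh S0]|[s [u [j [[uj ji hj] nh inv]]]]].
    have [[s hs]|nos] := pselect (exists s, hit s i).
      right; exists s, 0%N, i.
      have nhi : forall k, (0 <= k < i.+1)%N -> ~ hit (~~ s) k.
        move=> k /andP[_]; rewrite ltnS leq_eqVlt => /orP[/eqP->|ki]; last exact: nh.
        by move=> /(hboth _ hs).
      split=> //.
      have hc k : (k < i)%N -> eta k.+1 = eta k.
        move=> ki; have kn : (k < n)%N by lia.
        have [a1 _] := mono true _ kn (nh _ _ ki).
        have [a2 _] := mono false _ kn (nh _ _ ki).
        by move: a1 a2; rewrite /sgb !mul1r !mulN1r lerN2 => a1 a2; apply/eqP; rewrite eq_le a1 a2.
      have ei k : (k <= i)%N -> eta k = eta 0%N.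
        by elim: k => // k IHk ki; rewrite hc//; apply: IHk; lia.
      rewrite (Sabs _ s)//; last by apply: nhi; rewrite ltnSn.
      rewrite S0 (ei i)// /A.
      have := K0 0%N i; have := K0 0%N 0%N.
      have := ler_norm (- (sgb s * (f 0%N + eta 0%N))); rewrite normrN norm_sgb mulrDr.
      by lra.
    left; split.
      move=> s k; rewrite ltnS leq_eqVlt => /orP[/eqP-> hk|]; last exact: nh.
      by apply: nos; exists s.
    have nb b : ~ hit b i by move=> hb; apply: nos; exists b.
    rewrite SS S0 add0r.
    have [a1 _] := mono true _ iN (nb _); have [a2 _] := mono false _ iN (nb _).
    move: a1 a2; rewrite /sgb !mul1r !mulN1r lerN2 => a1 a2.
    by apply/eqP; rewrite normr_eq0 subr_eq0 eq_le a1 a2.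
  right; have [hs|hs] := pselect (hit (~~ s) i); last first.
    exists s, u, j; split; first by split=> //; lia.
      move=> k /andP[uk]; rewrite ltnS leq_eqVlt => /orP[/eqP-> //|ki].
      by apply: nh; rewrite uk.
    by rewrite (Sabs _ s)//; move: inv; lra.
  have nhi : ~ hit (~~ ~~ s) i by move=> /(hboth _ hs).
  exists (~~ s), i, i; split; first by [].
    by move=> k ki; have -> : k = i by lia.
  (* A change of direction costs [3 * h]: twice [sgb s * (f i + eta i) < h], and once the term [h]
     of [KP] on the finished run. The oscillation [h <= K k i] pays for each of the three, which
     turns [3 * K 0 j] into [3 * K 0 i]; the rest of [KP] turns [K 0 u] into [K 0 i]. Hence the
     final factor 4. *)
  have [k [jk ki hk]] := cross _ _ _ (ltnW ji) iN hj hs.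
  rewrite (Sabs _ (~~ s))// sgbN !mulNr.
  have i1 : (0 < i)%N by lia.
  have i1n : (i.-1 < n)%N by lia.
  have uin : (u <= i.-1 < i)%N by lia.
  have [_] := mono s _ i1n (nh _ uin); rewrite prednK// mulrDr => hlt.
  have ui : (u <= i)%N by lia.
  have := KP _ _ ui (ltnW iN).
  have := ler_norm (sgb s * (f u - f i)); rewrite norm_sgb mulrBr distrC.
  have : h <= K k i.
    apply: Kh; apply: le_trans (omP _ _ ki (ltnW iN)).
    by rewrite lerXn2r// nnegrE// ltW.
  have := KD j k i jk ki; have := K0 j k.
  have := KD 0%N j i isT (ltnW ji); have := KD 0%N u i isT ui.
  move: hlt inv; lra.
case: (main n (leqnn n)) => [[_ S0]|[s [u [j [[uj ji hj] nh inv]]]]].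
  rewrite -/(S n) S0 !addr_ge0 ?mulr_ge0// ?ltW//; exact: K0.
have n1n : (n.-1 < n)%N by lia.
have uin : (u <= n.-1 < n)%N by lia.
have [_] := mono s _ n1n (nh _ uin); rewrite prednK ?mulrDr => [hlt|]; last by lia.
have un : (u <= n)%N by lia.
have := KP _ _ un (leqnn n); rewrite -/(S n).
have := ler_norm (sgb s * (f u - f n)); rewrite norm_sgb mulrBr distrC.
have := KD 0%N j n isT (ltnW ji); have := KD 0%N u n isT un; have := K0 j n; have := K0 u n.
move: inv hlt; rewrite /A; lra.
Qed.

End Oscillation.

(** * The extended Skorokhod problem *)

Section ExtendedSkorokhod.
Context {R : realType}.
Implicit Types (l r : R -> \bar R) (psi phi eta g : R -> R).

Lemma near_leftP (t : R) (Q : R -> Prop) : (\forall u \near t^'-, Q u) ->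
  exists2 e, 0 < e & forall u, t - e < u -> u < t -> Q u.
Proof.
move=> /nbhs_ballP[e /= e0 he]; exists e => // u ut1 ut2.
by apply: he => //=; rewrite /ball /= ltr_norml; apply/andP; split; lra.
Qed.

Lemma near_rightP (t : R) (Q : R -> Prop) : (\forall u \near t^'+, Q u) ->
  exists2 e, 0 < e & forall u, t < u -> u < t + e -> Q u.
Proof.
move=> /nbhs_ballP[e /= e0 he]; exists e => // u ut1 ut2.
by apply: he => //=; rewrite /ball /= ltr_norml; apply/andP; split; lra.
Qed.

Lemma cadlagN (f : R -> R) : cadlag f -> cadlag (\- f).
Proof.
by move=> [f1 f2]; split=> t t0; [apply: cvgN; exact: f1|apply: is_cvgN; exact: f2].
Qed.

Lemma leftlim0N (f : R -> R) t : cadlag f -> 0 <= t ->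
  leftlim0 (\- f) t = - leftlim0 f t.
Proof.
move=> [_ f2]; rewrite le_eqVlt => /predU1P[<-|t0]; rewrite /leftlim0.
  by rewrite eqxx oppr0.
by rewrite gt_eqF// /leftlim; apply: limN; exact: f2.
Qed.

(** This symmetry allows [last_passage] and [ESP_crossing] to speak of the lower barrier alone. *)
Lemma ESP_opp l r psi phi eta : ESP l r psi phi eta ->
  ESP (fun t => - r t)%E (fun t => - l t)%E (\- psi) (\- phi) (\- eta).
Proof.
move=> [c1 c2 E1 E2 E3]; split.
- exact: cadlagN.
- exact: cadlagN.
- move=> t t0; have [e /andP[lp pr]] := E1 _ t0; split; first by rewrite /= e opprD.
  by rewrite /= EFinN !leeN2 lp pr.
- move=> s t s0 st; have [a1 a2] := E2 _ _ s0 st; split => h /=; rewrite lerN2.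
    by apply: a2 => u su ut; have := h u su ut; rewrite /= EFinN lteN2.
  by apply: a1 => u su ut; have := h u su ut; rewrite /= EFinN lteN2.
- move=> t t0; have [a1 a2] := E3 _ t0; rewrite leftlim0N//= EFinN !lteN2 !lerN2.
  by split.
Qed.

(* Follow [g] backwards from [y] to its last passage below [c]: either the lower barrier
   is active at some later time, or [eta] does not increase from there on. *)
Lemma last_passage l r psi phi eta g c x y : ESP l r psi phi eta -> cadlag g ->
  (forall t, 0 < t -> leftlim g t < g t -> leftlim eta t < eta t) ->
  0 <= x -> x <= y -> g x <= c ->
  (exists u, [/\ x < u, u <= y, ((phi u)%:E <= l u)%E &
      forall v, u <= v -> v <= y -> c < g v]) \/
  (exists x', [/\ x <= x', x' <= y, g x' <= c & eta y <= eta x']).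
Proof.
move=> [_ _ _ E2 E3] [_ gl] jump x0 xy gx.
pose A := [set u | x <= u <= y /\ g u <= c].
have Ax : A x by rewrite /A /= lexx xy.
have supA : has_sup A by split; [exists x|exists y => u [/andP[_ ->]]].
set z := sup A.
have xz : x <= z by apply: ub_le_sup => //; case: supA.
have zy : z <= y by apply: ge_sup; [exists x|move=> u [/andP[_ ->]]].
have gz v : z < v -> v <= y -> c < g v.
  move=> zv vy; rewrite ltNge; apply/negP => gv.
  have : v <= z by apply: ub_le_sup; [case: supA|split=> //; rewrite vy (le_trans xz (ltW zv))].
  by rewrite leNgt zv.
have z0 : 0 <= z by exact: le_trans xz.
have [gzc|gzc] := leP (g z) c.
  have [[u [zu uy pu]]|nu] := pselect (exists u, [/\ z < u, u <= y & ((phi u)%:E <= l u)%E]).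
    left; exists u; split=> //; first exact: le_lt_trans zu.
    by move=> v uv; apply: gz; exact: lt_le_trans uv.
  right; exists z; split=> //; have [_] := E2 _ _ z0 zy; apply=> u zu uy.
  by rewrite ltNge; apply/negP => pu; apply: nu; exists u.
(* The supremum is not attained, so [g] has left limit at most [c] at [z] and jumps up. Then [eta]
   jumps up as well, and condition (3) puts [phi z] at the lower barrier. *)
have {}xz : x < z by rewrite lt_neqAle xz andbT; apply/eqP => xz'; move: gzc; rewrite -xz' ltNge gx.
have z1 : 0 < z by exact: le_lt_trans xz.
left; exists z; split=> //; last first.
  by move=> v; rewrite le_eqVlt => /predU1P[<- //|zv]; exact: gz.
rewrite leNgt; apply/negP => pz; have [_ /(_ pz)] := E3 _ z0.
rewrite /leftlim0 gt_eqF// leNgt => /negP; apply; apply: jump => //.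
apply: le_lt_trans (gzc); rewrite leNgt; apply/negP => cg.
have /near_leftP[e e0 he] : \forall v \near z^'-, c < g v by exact: cvgr_gt (gl _ z1) _ cg.
have [u [/andP[xu uy] uc] uz] := sup_adherent e0 supA.
have : u <= z by apply: ub_le_sup; [case: supA|split=> //; rewrite xu].
rewrite le_eqVlt => /predU1P[uz'|uz'].
  by move: uc; rewrite uz' leNgt gzc.
by have := he _ uz uz'; rewrite ltNge uc.
Qed.

End ExtendedSkorokhod.

Section PathRegularity.
Context {R : realType}.
Implicit Types (f : R -> R).

Lemma within_ge0_continuousP f : {within [set t : R | 0 <= t], continuous f} ->
  forall t e, 0 <= t -> 0 < e ->
  exists2 d, 0 < d & forall u, 0 <= u -> `|u - t| < d -> `|f u - f t| < e.
Proof.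
move=> /subspace_continuousP fc t e t0 e0.
have /cvgrPdist_lt/(_ _ e0)/nbhs_ballP[d /= d0 hd] := fc t t0.
exists d => // u u0 ut; rewrite distrC; apply: hd => //.
by rewrite /ball /= distrC.
Qed.

Lemma within_ge0_at_right f t : {within [set t : R | 0 <= t], continuous f} ->
  0 <= t -> f u @[u --> t^'+] --> f t.
Proof.
move=> fc t0; apply/cvgrPdist_lt => e e0.
have [d d0 hd] := within_ge0_continuousP fc t0 e0.
near=> u; rewrite distrC; apply: hd; first by apply: (le_trans t0); near: u; exact: nbhs_right_ge.
have tu : t < u by near: u; exact: nbhs_right_gt.
rewrite gtr0_norm ?subr_gt0// ltrBlDr addrC.
near: u; apply: nbhs_right_lt; lra.
Unshelve. all: by end_near.
Qed.

Lemma within_ge0_at_left f t : {within [set t : R | 0 <= t], continuous f} ->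
  0 < t -> f u @[u --> t^'-] --> f t.
Proof.
move=> fc t0; apply/cvgrPdist_lt => e e0.
have [d d0 hd] := within_ge0_continuousP fc (ltW t0) e0.
near=> u; rewrite distrC; apply: hd; first by apply: ltW; near: u; exact: nbhs_left_gt.
have tu : u < t by near: u; exact: nbhs_left_lt.
rewrite ltr0_norm ?subr_lt0// opprB ltrBlDr addrC -ltrBlDr.
near: u; apply: nbhs_left_gt; lra.
Unshelve. all: by end_near.
Qed.

Lemma within_ge0_unif_continuous f p q e :
  {within [set t : R | 0 <= t], continuous f} -> 0 <= p -> 0 < e ->
  exists2 d, 0 < d & forall u v, p <= u <= q -> 0 <= v -> `|v - u| < d ->
    `|f v - f u| < e.
Proof.
move=> fc p0 e0; have e20 : 0 < e / 2 by rewrite divr_gt0.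
have /compact_near_coveringP := @segment_compact _ p q.
move=> /(_ _ (0 : R)^'+ (fun d u => 0 <= u -> forall v, 0 <= v -> `|v - u| < d -> `|f v - f u| < e)).
case.
  move=> u /=; rewrite in_itv /= => /andP[pu uq].
  have u0 : 0 <= u by exact: le_trans pu.
  have [d d0 hd] := within_ge0_continuousP fc u0 e20.
  have d20 : 0 < d / 2 by rewrite divr_gt0.
  exists ([set u' | `|u' - u| < d / 2], [set d' | d' < d / 2]) => /=.
    split; last exact: nbhs_right_lt.
    by apply/nbhs_ballP; exists (d / 2) => //= u'; rewrite /ball /= distrC.
  move=> [u' d'] /= [h1 h2] u'0 v v0 h3.
  have -> : f v - f u' = (f v - f u) - (f u' - f u) by ring.
  apply: le_lt_trans (ler_normB _ _) _; rewrite [e]splitr; apply: ltrD; apply: hd => //; last by lra.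
  have -> : v - u = (v - u') + (u' - u) by ring.
  by apply: le_lt_trans (ler_normD _ _) _; lra.
move=> d /= d0 hd; exists (d / 2); first by rewrite divr_gt0.
move=> u v /andP[pu uq] v0 vu; apply: (hd (d / 2)) => //=.
- by rewrite sub0r normrN gtr0_norm ?divr_gt0//; lra.
- by rewrite divr_gt0.
- by rewrite in_itv /= pu.
- exact: le_trans pu.
Qed.

End PathRegularity.

(** * Crossings of a band that the barriers do not enter *)

Section Crossing.
Context {R : realType}.
Implicit Types (l r : R -> \bar R) (psi phi eta : R -> R).

(** As [psi] is continuous, [phi] and [eta] have the same jumps. This is the hypothesis of
    [last_passage] for [g = phi]. *)
Lemma ESP_leftlim_lt l r psi phi eta : ESP l r psi phi eta ->
  {within [set t : R | 0 <= t], continuous psi} ->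
  forall t, 0 < t -> leftlim phi t < phi t -> leftlim eta t < eta t.
Proof.
move=> [_ [_ el] E1 _ _] pc t t0.
have [-> _] := E1 _ (ltW t0).
have -> : leftlim phi t = psi t + leftlim eta t.
  apply/cvg_lim => //.
  have : (psi \+ eta) u @[u --> t^'-] --> psi t + leftlim eta t.
    by apply: cvgD; [exact: within_ge0_at_left|exact: el].
  apply: cvg_trans; apply: near_eq_cvg; near=> u.
  by have [] // := E1 u; apply: ltW; near: u; exact: nbhs_left_gt.
by rewrite ltrD2l.
Unshelve. all: by end_near.
Qed.

(** After the last passage of [phi] below [a] the lower barrier is out of reach, being at most [a].
    So [eta] does not increase, and [psi] alone has to climb by [b - a]. *)
Lemma ESP_crossing l r psi phi eta p q a b x y : ESP l r psi phi eta ->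
  {within [set t : R | 0 <= t], continuous psi} -> 0 <= p ->
  (forall u, p < u -> u < q -> (l u <= a%:E)%E) ->
  p < x -> x <= y -> y < q -> phi x <= a -> b <= phi y ->
  exists x', [/\ x <= x', x' <= y & b - a <= psi y - psi x'].
Proof.
move=> H pc p0 la px xy yq xa yb.
have x0 : 0 <= x by exact: le_trans (ltW px).
have [phicad _ E1 _ _] := H.
have [[u [xu uy pu hu]]|[x' [xx' x'y phx' ee]]] :=
    last_passage H phicad (ESP_leftlim_lt H pc) x0 xy xa.
  have := le_trans pu (la u (lt_trans px xu) (le_lt_trans uy yq)).
  by rewrite lee_fin leNgt hu.
exists x'; split=> //.
have [e1 _] := E1 y (le_trans x0 xy); have [e2 _] := E1 x' (le_trans x0 xx').
move: phx' ee yb; rewrite e1 e2; lra.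
Qed.

Lemma ESP_crossing_sgb l r psi phi eta p q m h x y s : ESP l r psi phi eta ->
  {within [set t : R | 0 <= t], continuous psi} -> 0 <= p ->
  (forall u, p < u -> u < q -> (l u <= (m - h)%:E)%E) ->
  (forall u, p < u -> u < q -> ((m + h)%:E <= r u)%E) ->
  p < x -> x <= y -> y < q -> sgb s * (phi x - m) <= - h -> sgb (~~ s) * (phi y - m) <= - h ->
  exists x', [/\ x <= x', x' <= y & 2 * h <= `|psi y - psi x'|].
Proof.
move=> H pc p0 la rb px xy yq; case: s; rewrite /sgb /= mul1r mulN1r => hx hy.
  have hx' : phi x <= m - h by lra.
  have hy' : m + h <= phi y by lra.
  have [x' [xx' x'y hb]] := ESP_crossing H pc p0 la px xy yq hx' hy'.
  exists x'; split => //; apply: le_trans (ler_norm _); lra.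
have pcN : {within [set t : R | 0 <= t], continuous (\- psi)}.
  apply/subspace_continuousP => u u0; move/subspace_continuousP : pc => /(_ _ u0) pc.
  exact: cvgN.
have la' u : p < u -> u < q -> (- r u <= (- (m + h))%:E)%E.
  by move=> pu uq; rewrite EFinN leeN2; exact: rb.
have hx' : (\- phi) x <= - (m + h) by rewrite /=; lra.
have hy' : - (m - h) <= (\- phi) y by rewrite /=; lra.
have [x' [xx' x'y hb]] := ESP_crossing (ESP_opp H) pcN p0 la' px xy yq hx' hy'.
exists x'; split => //; rewrite -normrN; apply: le_trans (ler_norm _); move: hb => /=; lra.
Qed.

End Crossing.

(** * Variation on one interval *)

Section VariationLemmas.
Context {R : realType}.
Implicit Types (f : R -> R) (p q : R).

Lemma total_variation_sum f (g : nat -> R) n : (forall i, (i < n)%N -> g i <= g i.+1) ->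
  total_variation (g 0%N) (g n) f =
    (\sum_(0 <= i < n) total_variation (g i) (g i.+1) f)%E.
Proof.
elim: n => [|n IH] gS; first by rewrite total_variationxx big_geq.
rewrite big_nat_recr//= -IH => [|i ni]; last by apply: gS; exact: ltnW.
have gle : forall k, (k <= n)%N -> g 0%N <= g k.
  elim => // k IHk kn; apply: le_trans (IHk (ltnW kn)) _; apply: gS; exact: ltnW.
by apply: total_variationD; [exact: gle|exact: gS].
Qed.

Lemma le_total_variation f a b c d : a <= c -> c <= d -> d <= b ->
  (total_variation c d f <= total_variation a b f)%E.
Proof.
move=> ac cd db.
rewrite (@total_variationD _ a b c)// ?(le_trans cd)//.
rewrite (@total_variationD _ c b d)//.
apply: (@le_trans _ _ (total_variation c d f + total_variation d b f)%E).
  by rewrite leeDl// total_variation_ge0.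
by rewrite leeDr// total_variation_ge0.
Qed.

Lemma monotone_total_variation f p q s : p <= q ->
  (forall u v, p <= u -> u <= v -> v <= q -> sgb s * f u <= sgb s * f v) ->
  total_variation p q f = `|f q - f p|%:E.
Proof.
case: s; rewrite /sgb => pq mono.
  rewrite nondecreasing_total_variation//.
    by rewrite ger0_norm// subr_ge0; have := mono p q; rewrite !mul1r; apply.
  move=> u v; rewrite !in_itv /= => /andP[pu _] /andP[_ vq] uv.
  by have := mono u v; rewrite !mul1r; apply.
rewrite -total_variationN nondecreasing_total_variation//.
  rewrite ler0_norm; first by congr EFin => /=; lra.
  by rewrite subr_le0; have := mono p q; rewrite !mulN1r lerN2; apply.
move=> u v; rewrite !in_itv /= => /andP[pu _] /andP[_ vq] uv.
by have := mono u v; rewrite !mulN1r; apply.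
Qed.

(** Refine a partition by a point [c] close to [q] and beyond all its nodes below [q]. Up to [c] the
    bound [M] applies, and the single step left, from [c] to [q], tends to [|f q - L|]. *)
Lemma total_variation_left_limit f p q M L : p < q ->
  (forall q', p <= q' -> q' < q -> (total_variation p q' f <= M)%E) ->
  f u @[u --> q^'-] --> L ->
  (total_variation p q f <= M + `|f q - L|%:E)%E.
Proof.
move=> pq hM fL; apply: ge_ereal_sup => _ [_ [s ps <-] <-].
apply/lee_addgt0Pr => e e0; rewrite -addeA -EFinD.
have [c [c1 c2 c3]] : exists c, [/\ c < q, (forall z, z \in p :: s -> z < q -> z < c) &
    `|L - f c| < e].
  have /near_leftP[d d0 hd] : \forall u \near q^'-, `|L - f u| < e.
    by move/cvgrPdist_lt : fL; exact.
  have [c0 [c0q hc0]] : exists c0, c0 < q /\ forall z, z \in p :: s -> z < q -> z <= c0.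
    elim: (p :: s) => [|z t [c0 [c0q hc0]]]; first by exists p.
    have [zq|zq] := ltP z q; last first.
      exists c0; split=> // y; rewrite inE => /predU1P[->|]; last exact: hc0.
      by rewrite ltNge zq.
    exists (Num.max c0 z); rewrite gt_max c0q zq; split=> // y.
    rewrite inE le_max => /predU1P[->|yt yq]; first by rewrite lexx orbT.
    by rewrite hc0.
  pose c := (Num.max c0 (q - d) + q) / 2.
  have mq : Num.max c0 (q - d) < q by rewrite gt_max c0q; lra.
  have c0m : c0 <= Num.max c0 (q - d) by rewrite le_max lexx.
  have dm : q - d <= Num.max c0 (q - d) by rewrite le_max lexx orbT.
  exists c; split; first by rewrite /c; lra.
    by move=> z zs zq; have := hc0 _ zs zq; rewrite /c; lra.
  by apply: hd; rewrite /c; lra.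
have pc : p < c by apply: c2; rewrite ?mem_head.
apply: (@le_trans _ _ (variation p q f (itv_partitionL s c ++ itv_partitionR s c))%:E).
  by rewrite lee_fin variation_itv_partitionLR.
rewrite (variation_cat _ (ltW pc) (ltW c1)); [|exact: itv_partitionLP pc c1 ps|exact: itv_partitionRP pc c1 ps].
rewrite [leLHS]EFinD; apply: leeD.
  apply: le_trans (hM c (ltW pc) c1); apply: ereal_sup_ubound.
  by exists (variation p c f (itv_partitionL s c)) => //; exact: variations_variation (itv_partitionLP pc c1 ps).
have -> : itv_partitionR s c = [:: q].
  have := itv_partitionRP pc c1 ps => -[].
  have : forall z, z \in itv_partitionR s c -> q <= z.
    move=> z; rewrite mem_filter => /andP[cz zs]; rewrite leNgt; apply/negP => zq.
    by have := c2 z; rewrite inE zs orbT => /(_ isT zq); rewrite ltNge ltW.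
  case: (itv_partitionR s c) => [_ _ /= /eqP cq|z1 [|z2 t] hq /=].
  - by move: c1; rewrite cq ltxx.
  - by move=> _ /eqP ->.
  - move=> /andP[_ /andP[z12 zt]] /eqP zl.
    have z1q := hq z1 (mem_head _ _).
    have : z2 <= q.
      rewrite -zl; apply: (@itv_partition_le _ _ z2 _ t); split=> //.
    by rewrite leNgt (le_lt_trans z1q z12).
rewrite /variation /= big_nat1 lee_fin /=.
have -> : f q - f c = (f q - L) + (L - f c) by ring.
by apply: le_trans (ler_normD _ _) _; rewrite lerD2l ltW.
Qed.

Lemma total_variation_right_limit f p q M L : p < q ->
  (forall p', p < p' -> p' <= q -> (total_variation p' q f <= M)%E) ->
  f u @[u --> p^'+] --> L ->
  (total_variation p q f <= M + `|f p - L|%:E)%E.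
Proof.
move=> pq hM fL; rewrite total_variation_opp.
have := @total_variation_left_limit (f \o -%R) (- q) (- p) M L.
rewrite /= opprK; apply; first by rewrite ltrN2.
  move=> q' q1 q2; rewrite -[q']opprK -total_variation_opp; apply: hM; lra.
by apply/cvg_at_leftNP; rewrite opprK; apply: cvg_trans fL; apply: near_eq_cvg; near=> u; rewrite /= opprK.
Unshelve. all: by end_near.
Qed.

End VariationLemmas.

(** * Dyadic grids and the pathwise estimate on them *)

Section DyadicGrid.
Context {R : realType}.
Implicit Types (p q : R).

Definition grid p q (N i : nat) : R := p + (q - p) * (i%:R / 2 ^+ N).

Lemma grid0 p q N : grid p q N 0 = p.
Proof. by rewrite /grid mul0r mulr0 addr0. Qed.

Lemma gridE p q N : grid p q N (2 ^ N) = q.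
Proof. by rewrite /grid natrX divff ?expf_neq0// mulr1 addrC subrK. Qed.

Lemma gridS p q N i : grid p q N i.+1 - grid p q N i = (q - p) / 2 ^+ N.
Proof. by rewrite /grid -natr1; set c := _^-1; ring. Qed.

Lemma ltr_grid p q N : p < q -> {mono grid p q N : i j / (i < j)%N >-> i < j}.
Proof.
move=> pq i j; rewrite /grid ltrD2l ltr_pM2l ?subr_gt0//.
by rewrite ltr_pM2r ?invr_gt0 ?exprn_gt0// ltr_nat.
Qed.

Lemma ler_grid p q N : p < q -> {mono grid p q N : i j / (i <= j)%N >-> i <= j}.
Proof.
move=> pq i j; rewrite /grid lerD2l ler_pM2l ?subr_gt0//.
by rewrite ler_pM2r ?invr_gt0 ?exprn_gt0// ler_nat.
Qed.

Lemma grid_ge p q N i : p < q -> p <= grid p q N i.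
Proof. by move=> pq; rewrite -{1}(grid0 p q N) ler_grid. Qed.

Lemma grid_refine p q N n i : (n <= N)%N -> grid p q N (i * 2 ^ (N - n)) = grid p q n i.
Proof.
move=> nN; rewrite /grid natrM natrX; congr (_ + _ * _).
have -> : 2 ^+ N = 2 ^+ n * 2 ^+ (N - n) :> R by rewrite -exprD subnKC.
by rewrite -mulrA invfM; congr (_ * _); rewrite mulrCA divff ?expf_neq0// mulr1.
Qed.

Lemma grid_window p q N x i j : (i <= j)%N -> grid p q N i < x -> x <= grid p q N j ->
  exists k, [/\ (i <= k)%N, (k < j)%N, grid p q N k < x & x <= grid p q N k.+1].
Proof.
move=> ij ix; elim: j ij => [|j IH].
  by rewrite leqn0 => /eqP i0; rewrite leNgt -i0 ix.
rewrite leq_eqVlt => /predU1P[<-|]; first by rewrite leNgt ix.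
rewrite ltnS => ij xj; have [xj'|xj'] := leP x (grid p q N j).
  by have [k [? ? ? ?]] := IH ij xj'; exists k; split=> //; exact: ltnW.
by exists j.
Qed.

(** The last window is left out because a barrier may enter the band at [q]. At [p] this does no
    harm, since condition (2) ignores the left end of an interval. *)
Lemma ESP_variation_grid (l r : R -> \bar R) psi phi eta p q m h : ESP l r psi phi eta ->
  {within [set t : R | 0 <= t], continuous psi} -> 0 <= p -> p < q -> 0 < h ->
  (forall u, p < u -> u < q -> (l u <= (m - h)%:E)%E) ->
  (forall u, p < u -> u < q -> ((m + h)%:E <= r u)%E) ->
  exists N0, forall N, (N0 <= N)%N ->
    (total_variation p (grid p q N (2 ^ N).-1) eta <=
     (`|phi p - m| + 2 * h +
      4 * (dyadic_control (psi \o grid p q N) N 0 (2 ^ N) / h ^+ 3))%:E)%E.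
Proof.
move=> H pc p0 pq h0 la rb.
(* The band has width [2 * h]. If [psi] moves by less than [h / 2] within a window, replacing both
   ends of a crossing by grid points still leaves an oscillation of [h]. *)
have h20 : 0 < h / 2 by rewrite divr_gt0.
have [dl dl0 hdl] := within_ge0_unif_continuous q pc p0 h20.
have [N0 hN0] : exists N0, forall N, (N0 <= N)%N -> (q - p) / 2 ^+ N < dl.
  have qd0 : 0 <= (q - p) / dl by apply: divr_ge0; rewrite ?subr_ge0 ltW.
  exists (Num.truncn ((q - p) / dl)).+1 => N N0N.
  rewrite ltr_pdivrMr ?exprn_gt0// mulrC -ltr_pdivrMr//.
  have := truncnS_gt ((q - p) / dl) => /lt_le_trans; apply.
  rewrite -natrX ler_nat; apply: leq_trans N0N _; exact: ltnW (ltn_expl _ _).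
exists N0 => N /hN0 hN.
set g := grid p q N; set n := (2 ^ N).-1.
have n2 : n.+1 = (2 ^ N)%N by rewrite /n prednK// expn_gt0.
have gn_lt i : (i <= n)%N -> g i < q.
  by move=> i_n; rewrite -(gridE p q N) ltr_grid// -n2 ltnS.
have gp i : p <= g i by exact: grid_ge.
have g0 i : 0 <= g i by exact: le_trans (gp i).
have gle i j : (i <= j)%N -> g i <= g j by move=> ij; rewrite ler_grid.
have gS i : g i.+1 - g i < dl by rewrite gridS.
have [_ _ E1 E2 _] := H.
(* The windows are open on the left to match the intervals [(s, t]] of condition (2). *)
pose hit (s : bool) i := exists x, [/\ g i < x, x <= g i.+1 & sgb s * (phi x - m) <= - h].
have osc i x : (i < n)%N -> g i < x -> x <= g i.+1 -> `|psi x - psi (g i)| < h / 2.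
  move=> i_n ix xi; apply: hdl; first by rewrite gp ltW// gn_lt// ltnW.
    exact: le_trans (g0 i) (ltW ix).
  by rewrite gtr0_norm ?subr_gt0//; have := gS i; lra.
have mono s i u v : (i < n)%N -> ~ hit (~~ s) i -> g i <= u -> u <= v -> v <= g i.+1 ->
    sgb s * eta u <= sgb s * eta v.
  move=> i_n nh iu uv vi.
  have hx x : u < x -> x <= v -> sgb s * (phi x - m) < h.
    move=> ux xv; rewrite ltNge; apply/negP => hx; apply: nh; exists x; split.
    - exact: le_lt_trans ux.
    - exact: le_trans vi.
    - by rewrite sgbN mulNr lerN2.
  have u0 : 0 <= u by exact: le_trans iu.
  have xq x : x <= v -> x < q.
    by move=> xv; apply: (le_lt_trans xv); apply: (le_lt_trans vi); exact: gn_lt.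
  have px x : u < x -> p < x by move=> ux; apply: le_lt_trans ux; exact: le_trans iu.
  have [e1 e2] := E2 _ _ u0 uv; case: s nh hx => nh hx; rewrite /sgb.
    rewrite !mul1r; apply: e1 => x ux xv.
    apply: (@lt_le_trans _ _ (m + h)%:E); last by apply: rb; [exact: px|exact: xq].
    by rewrite lte_fin; have := hx _ ux xv; rewrite /sgb mul1r; lra.
  rewrite !mulN1r lerN2; apply: e2 => x ux xv.
  apply: (@le_lt_trans _ _ (m - h)%:E); first by apply: la; [exact: px|exact: xq].
  by rewrite lte_fin; have := hx _ ux xv; rewrite /sgb mulN1r; lra.
have cross1 s i j x y : (j <= i)%N -> (i < n)%N -> x <= y ->
    g j < x -> x <= g j.+1 -> g i < y -> y <= g i.+1 ->
    sgb s * (phi x - m) <= - h -> sgb (~~ s) * (phi y - m) <= - h ->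
    exists k, [/\ (j <= k)%N, (k <= i)%N & h <= `|psi (g i) - psi (g k)|].
  move=> ji i_n xy jx xj iy yi hx hy.
  have px : p < x by exact: le_lt_trans jx.
  have yq : y < q by apply: le_lt_trans yi _; exact: gn_lt.
  have [x' [xx' x'y hh]] := ESP_crossing_sgb H pc p0 la rb px xy yq hx hy.
  have jx' : g j < x' by exact: lt_le_trans xx'.
  have x'i : x' <= g i.+1 by exact: le_trans yi.
  have [k [jk ki kx' x'k]] := grid_window (leq_trans ji (leqnSn i)) jx' x'i.
  exists k; split=> //.
  have := osc i y i_n iy yi; have := osc k x' (leq_ltn_trans (ki : (k <= i)%N) i_n) kx' x'k.
  have := ler_distD (psi (g i)) (psi y) (psi x').
  have := ler_distD (psi (g k)) (psi (g i)) (psi x').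
  rewrite (distrC (psi (g k))); move: hh; lra.
have cross s i j : (j <= i)%N -> (i < n)%N -> hit s j -> hit (~~ s) i ->
    exists k, [/\ (j <= k)%N, (k <= i)%N & h <= `|psi (g i) - psi (g k)|].
  move=> ji i_n [x [jx xj hx]] [y [iy yi hy]].
  have [xy|yx] := leP x y; first exact: (cross1 s _ _ x y).
  have ij : i = j.
    apply/eqP; rewrite eqn_leq ji andbT leqNgt; apply/negP => ltji.
    by have := le_lt_trans (le_trans xj (gle _ _ ltji)) iy; rewrite ltNge ltW.
  move: ij => ?; subst j.
  by apply: (cross1 (~~ s) i i y x); rewrite ?negbK// ltW.
have nhit i : (i < n)%N -> exists s, ~ hit (~~ s) i.
  move=> i_n; have [ht|ht] := pselect (hit true i); last by exists false.
  exists true => hf; have [k [ik ki]] := cross true i i (leqnn i) i_n ht hf.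
  have -> : k = i by apply/eqP; rewrite eqn_leq ik ki.
  by rewrite subrr normr0 leNgt h0.
rewrite -{1}(grid0 p q N) -/g total_variation_sum => [|i _]; last exact: gle.
(* Sampling loses nothing: no window is hit in both directions, so [eta] is monotone on each of
   them. *)
rewrite (eq_big_nat _ _ (F2 := fun i => `|eta (g i.+1) - eta (g i)|%:E)); last first.
  move=> i /andP[_ i_n]; have [s ns] := nhit i i_n.
  apply: (@monotone_total_variation _ _ _ _ s); first exact: gle.
  by move=> u v iu uv vi; exact: (mono s i).
rewrite sumEFin lee_fin.
pose om := dyadic_control (psi \o g) N.
have := @discrete_variation_le R n (fun i => psi (g i) - m) (fun i => eta (g i)) h hit om h0.
have -> : psi (g 0%N) - m + eta (g 0%N) = phi p - m.
  by have [-> _] := E1 _ p0; rewrite /g grid0; ring.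
move=> /(_ _ _ _ _ _)/le_trans; apply.
- by move=> i j; exact: dyadic_control_ge0.
- by move=> i j k ij jk; exact: dyadic_control_superadditive.
- move=> i j ij jn; have -> : psi (g j) - m - (psi (g i) - m) = psi (g j) - psi (g i) by ring.
  by apply: (@dyadic_controlP _ (psi \o g) N) => //; rewrite -n2; exact: leqW.
- move=> s i i_n nh; split; first by apply: (mono s i) => //; exact: gle.
  have -> : psi (g i.+1) - m + eta (g i.+1) = phi (g i.+1) - m.
    by have [-> _] := E1 _ (g0 i.+1); ring.
  rewrite ltNge; apply/negP => hx; apply: nh; exists (g i.+1); split=> //.
    by rewrite ltr_grid.
  by rewrite sgbN mulNr lerN2.
- move=> s i j ji i_n hj hi; have [k [jk ki hk]] := cross s i j ji i_n hj hi.
  by exists k; split=> //; move: hk; congr (_ <= `|_|); ring.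
rewrite lerD2l ler_wpM2l// ler_wpM2r ?invr_ge0 ?exprn_ge0 ?(ltW h0)// /om.
have nN : (n <= 2 ^ N)%N by rewrite -n2.
have := @dyadic_control_superadditive _ (psi \o g) N 0 n (2 ^ N) isT nN.
by have := dyadic_control_ge0 (psi \o g) N n (2 ^ N); lra.
Qed.

End DyadicGrid.

Section IntervalVariation.
Context {R : realType}.
Implicit Types (l r : R -> \bar R) (psi phi eta f : R -> R) (p q : R).

(** The quantity [Q] of the overview: it dominates the controls of all levels [N] at once and, being
    a series over deterministic times, is measurable in the path and can be integrated term by
    term. *)
Definition dyadic_energy f p q : \bar R :=
  (\sum_(0 <= n <oo) (125 * 16 * (125 / 64) ^+ n *
     \sum_(0 <= k < 2 ^ n) `|f (grid p q n k.+1) - f (grid p q n k)| ^+ 4)%:E)%E.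

Lemma dyadic_energy_term_ge0 f p q n : 0 <= 125 * 16 * (125 / 64) ^+ n *
     \sum_(0 <= k < 2 ^ n) `|f (grid p q n k.+1) - f (grid p q n k)| ^+ 4.
Proof.
apply: mulr_ge0; last by apply: sumr_ge0 => k _; rewrite exprn_ge0.
by apply: mulr_ge0; rewrite ?exprn_ge0.
Qed.

Lemma dyadic_energy_ge0 f p q : (0 <= dyadic_energy f p q)%E.
Proof. by apply: nneseries_ge0 => n _ _; rewrite lee_fin dyadic_energy_term_ge0. Qed.

Lemma dyadic_control_le_energy f p q N :
  ((dyadic_control (f \o grid p q N) N 0 (2 ^ N))%:E <= dyadic_energy f p q)%E.
Proof.
apply: le_trans (nneseries_lim_ge N.+1 _) => [|n _ _]; last first.
  by rewrite lee_fin dyadic_energy_term_ge0.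
rewrite sumEFin lee_fin /dyadic_control mulr_sumr big_mkord.
apply: ler_sum => n _; rewrite mulrA ler_wpM2l//.
have nN : (n <= N)%N by rewrite -ltnS.
rewrite /dyadic_sum big_mkcond /=; apply: ler_sum => k _.
by case: ifP => _; rewrite ?exprn_ge0// !grid_refine.
Qed.

Lemma lee_abs_between (u v y : \bar R) (m : R) : (u <= y)%E -> (y <= v)%E -> y \is a fin_num ->
  (`|y - m%:E| <= `|v - m%:E| + `|u - m%:E|)%E.
Proof.
move=> uy yv /fineK yE; move: uy yv; rewrite -yE; set z := fine y; case: u => [u| |]//; case: v => [v| |]//=.
- rewrite !lee_fin => uz zv.
  have [mz|mz] := leP m z.
    rewrite ger0_norm ?subr_ge0//; have := ler_norm (v - m); have := normr_ge0 (u - m); lra.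
  rewrite ltr0_norm ?subr_lt0//; have := ler_norm (m - u); rewrite distrC.
  have := normr_ge0 (v - m); lra.
- by move=> _ _; rewrite leey.
- by move=> _ _; rewrite leey.
- by move=> _ _; rewrite leey.
Qed.

Lemma at_left_le_lim l phi q (L : R) : 0 < q -> cadlag l -> phi u @[u --> q^'-] --> L ->
  (forall t, 0 <= t -> (l t <= (phi t)%:E)%E) -> (leftlim l q <= L%:E)%E.
Proof.
move=> q0 [_ lc] pL lp.
have cL : (phi u)%:E @[u --> q^'-] --> L%:E by apply: cvg_EFin => //; apply: nearW.
rewrite -(cvg_lim _ cL)//; apply: lee_lim; [exact: lc|by apply/cvg_ex; exists L%:E|].
by near=> u; apply: lp; apply: ltW; near: u; exact: nbhs_left_gt.
Unshelve. all: by end_near.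
Qed.

Lemma at_left_ge_lim r phi q (L : R) : 0 < q -> cadlag r -> phi u @[u --> q^'-] --> L ->
  (forall t, 0 <= t -> ((phi t)%:E <= r t)%E) -> (L%:E <= leftlim r q)%E.
Proof.
move=> q0 [_ lc] pL lp.
have cL : (phi u)%:E @[u --> q^'-] --> L%:E by apply: cvg_EFin => //; apply: nearW.
rewrite -(cvg_lim _ cL)//; apply: lee_lim; [by apply/cvg_ex; exists L%:E|exact: lc|].
by near=> u; apply: lp; apply: ltW; near: u; exact: nbhs_left_gt.
Unshelve. all: by end_near.
Qed.

Lemma ESP_eta_cvg_left l r psi phi eta q : ESP l r psi phi eta ->
  {within [set t : R | 0 <= t], continuous psi} -> 0 < q ->
  eta u @[u --> q^'-] --> leftlim phi q - psi q.
Proof.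
move=> [[_ pl] _ E1 _ _] pc q0.
have : (phi \- psi) u @[u --> q^'-] --> leftlim phi q - psi q.
  by apply: cvgB; [exact: pl|exact: within_ge0_at_left].
apply: cvg_trans; apply: near_eq_cvg; near=> u => /=.
have u0 : 0 <= u by apply: ltW; near: u; exact: nbhs_left_gt.
by have [-> _] := E1 u u0; ring.
Unshelve. all: by end_near.
Qed.

(** The last group pays for the jump at [q]. Since [psi] is continuous, [eta] jumps there by
    [phi q - leftlim phi q], and these two values lie between the barriers, respectively between
    their left limits. *)
Lemma ESP_variation_itv l r psi phi eta p q m h : ESP l r psi phi eta ->
  cadlag l -> cadlag r ->
  {within [set t : R | 0 <= t], continuous psi} -> 0 <= p -> p < q -> 0 < h ->
  (forall u, p < u -> u < q -> (l u <= (m - h)%:E)%E) ->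
  (forall u, p < u -> u < q -> ((m + h)%:E <= r u)%E) ->
  (total_variation p q eta <=
    (`|r p - m%:E| + `|l p - m%:E|) + ((2 * h)%:E + (4 / h ^+ 3)%:E * dyadic_energy psi p q) +
    ((`|r q - m%:E| + `|l q - m%:E|) + (`|leftlim r q - m%:E| + `|leftlim l q - m%:E|)))%E.
Proof.
move=> H lc rc pc p0 pq h0 la rb.
have [pcad ecad E1 _ _] := H.
have q0 : 0 < q by exact: le_lt_trans pq.
have [N0 hN0] := ESP_variation_grid H pc p0 pq h0 la rb.
have jump := ESP_eta_cvg_left H pc q0.
have lphi t : 0 <= t -> (l t <= (phi t)%:E)%E by move=> /E1[_ /andP[]].
have phir t : 0 <= t -> ((phi t)%:E <= r t)%E by move=> /E1[_ /andP[]].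
apply: (le_trans (total_variation_left_limit (M := (`|r p - m%:E| + `|l p - m%:E|) +
    ((2 * h)%:E + (4 / h ^+ 3)%:E * dyadic_energy psi p q)) pq _ jump)).
  move=> q' pq' q'q.
  have [N NN0 hN] : exists2 N, (N0 <= N)%N & q' <= grid p q N (2 ^ N).-1.
    have qq0 : 0 < q - q' by rewrite subr_gt0.
    exists (maxn N0 (Num.truncn ((q - p) / (q - q'))).+1); first exact: leq_maxl.
    set N := maxn _ _.
    have := gridS p q N (2 ^ N).-1; rewrite prednK ?expn_gt0// gridE => e.
    rewrite -(lerD2r ((q - p) / 2 ^+ N)) -{2}e.
    suff : (q - p) / 2 ^+ N <= q - q' by lra.
    rewrite ler_pdivrMr ?exprn_gt0// mulrC -ler_pdivrMr// ltW//.
    have := truncnS_gt ((q - p) / (q - q')) => /lt_le_trans; apply.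
    rewrite -natrX ler_nat; apply: leq_trans (leq_maxr N0 _) _; exact: ltnW (ltn_expl _ _).
  apply: (le_trans (le_total_variation eta (lexx p) pq' hN)).
  apply: (le_trans (hN0 _ NN0)).
  rewrite -addrA EFinD; apply: leeD.
    by apply: (@lee_abs_between _ _ (phi p)%:E); [exact: lphi|exact: phir|].
  rewrite [leLHS]EFinD leeD2l//.
  rewrite (_ : 4 * (_ / _) = 4 / h ^+ 3 * dyadic_control (psi \o grid p q N) N 0 (2 ^ N)); last by ring.
  rewrite EFinM.
  apply: lee_wpmul2l; last exact: dyadic_control_le_energy.
  by rewrite lee_fin divr_ge0// exprn_ge0// ltW.
apply: leeD => //.
have [e _] := E1 q (ltW q0).
have -> : eta q - (leftlim phi q - psi q) = (phi q - m) - (leftlim phi q - m) by rewrite e; ring.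
apply: (@le_trans _ _ (`|phi q - m|%:E + `|leftlim phi q - m|%:E)%E).
  by rewrite -EFinD lee_fin ler_normB.
have [_ pl] := pcad.
apply: leeD.
  by apply: (@lee_abs_between _ _ (phi q)%:E); [exact/lphi/ltW|exact/phir/ltW|].
apply: (@lee_abs_between _ _ (leftlim phi q)%:E) => //.
  by apply: at_left_le_lim lphi => //; exact: pl.
by apply: at_left_ge_lim phir => //; exact: pl.
Qed.

End IntervalVariation.

(** * Brownian moments *)

Section NormalMoment.
Context {R : realType}.
Local Notation mu := (@lebesgue_measure R).

(** The Radon-Nikodym derivative and the density have the same integral over every measurable set,
    so they agree almost everywhere. *)
Lemma ge0_integral_normal_prob (m s : R) (f : R -> \bar R) :
  measurable_fun [set: measurableTypeR R] f -> (forall x, (0 <= f x)%E) ->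
  (\int[normal_prob m s]_x f x = \int[mu]_x (f x * (normal_pdf m s x)%:E))%E.
Proof.
move=> mf f0.
have dom := @normal_prob_dominates R m s.
rewrite -(Radon_Nikodym_SigmaFinite.change_of_variables dom f0)//.
apply: ae_eq_integral => //.
- apply: emeasurable_funM => //; apply: (measurable_int mu).
  exact: Radon_Nikodym_SigmaFinite.f_integrable.
- by apply: emeasurable_funM => //; apply/measurable_EFinP; exact: measurable_normal_pdf.
- apply: ae_eqe_mul2l => /=; apply: integral_ae_eq => //=.
  + exact: Radon_Nikodym_SigmaFinite.f_integrable.
  + by apply/measurable_EFinP; exact: measurable_normal_pdf.
  + by move=> E _ mE; rewrite -Radon_Nikodym_SigmaFinite.f_integral.
Qed.

(* [x ^ 4 / s ^ 4] is absorbed by part of the Gaussian exponent, at the price of doubling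
   the standard deviation. *)
Lemma exp4_normal_pdf_le (s x : R) : 0 < s ->
  x ^+ 4 * normal_pdf 0 s x <= 30 * s ^+ 4 * normal_pdf 0 (2 * s) x.
Proof.
move=> s0; have s20 : 0 < 2 * s by rewrite mulr_gt0.
rewrite !normal_pdfE ?gt_eqF// /normal_peak /normal_fun !subr0.
have -> : (2 * s) ^+ 2 * pi *+ 2 = 2 ^+ 2 * (s ^+ 2 * pi *+ 2) :> R by rewrite exprMn -mulrA mulrnAr.
rewrite sqrtrM ?sqr_ge0// sqrtr_sqr ger0_norm// invfM.
set c := (Num.sqrt _)^-1; have c0 : 0 <= c by rewrite invr_ge0 sqrtr_ge0.
(* The difference of the exponents [x ^ 2 / (2 * s ^ 2)] and [x ^ 2 / (8 * s ^ 2)]. From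
   [y ^ 2 * expR (- y) <= 2] comes the constant [128 / 9 <= 15], and 15 becomes 30 because the peak
   of the wider density is half as high. *)
pose y := 3 * x ^+ 2 / (8 * s ^+ 2).
have y0 : 0 <= y by rewrite divr_ge0// mulr_ge0// sqr_ge0.
have ss : s ^+ 2 != 0 by rewrite expf_neq0// gt_eqF.
have -> : - x ^+ 2 / (s ^+ 2 *+ 2) = - y + - x ^+ 2 / ((2 * s) ^+ 2 *+ 2).
  by rewrite /y -(mulr_natr (s ^+ 2)) -(mulr_natr ((2 * s) ^+ 2)) exprMn; field; rewrite gt_eqF.
rewrite expRD; set g := expR (- x ^+ 2 / _); have g0 : 0 <= g by rewrite expR_ge0.
have x4 : x ^+ 4 = 64 / 9 * s ^+ 4 * y ^+ 2.
  by rewrite /y; field; rewrite gt_eqF.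
have ey : y ^+ 2 * expR (- y) <= 2.
  rewrite expRN ler_pdivrMr ?expR_gt0//.
  have := expR_ge1Dxn 1 y0; rewrite (_ : 2`! = 2)%N//.
  lra.
have -> : x ^+ 4 * (c * (expR (- y) * g)) = 64 / 9 * (y ^+ 2 * expR (- y)) * (s ^+ 4 * c * g).
  by rewrite x4; ring.
have -> : 30 * s ^+ 4 * (2^-1 * c * g) = 15 * (s ^+ 4 * c * g).
  by field.
by apply: ler_wpM2r; [apply: mulr_ge0 => //; apply: mulr_ge0 => //; rewrite exprn_ge0// ltW|lra].
Qed.

Lemma normal_prob_moment4_le (s : R) : 0 < s ->
  (\int[normal_prob 0 s]_x (`|x| ^+ 4)%:E <= (30 * s ^+ 4)%:E)%E.
Proof.
move=> s0.
have mX : measurable_fun [set: measurableTypeR R] (fun x : R => (`|x| ^+ 4)%:E).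
  by apply/measurable_EFinP; apply: measurable_funX; exact: normr_measurable.
rewrite ge0_integral_normal_prob; [|exact: mX|by move=> x; rewrite lee_fin exprn_ge0].
apply: (@le_trans _ _ (\int[mu]_x ((30 * s ^+ 4)%:E * (normal_pdf 0 (2 * s) x)%:E))%E).
  apply: ge0_le_integral => //.
  - by move=> x _; apply: mule_ge0; rewrite lee_fin ?normal_pdf_ge0 ?exprn_ge0.
  - by apply: emeasurable_funM => //; apply/measurable_EFinP; exact: measurable_normal_pdf.
  - by apply: emeasurable_funM => //; apply/measurable_EFinP; exact: measurable_normal_pdf.
  - move=> x _; rewrite -!EFinM lee_fin.
    have -> : `|x| ^+ 4 = x ^+ 4 by rewrite -normrX ger0_norm// (exprM x 2 2) sqr_ge0.
    exact: exp4_normal_pdf_le.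
rewrite ge0_integralZl//.
- by rewrite integral_normal_pdf mule1.
- by apply/measurable_EFinP; exact: measurable_normal_pdf.
- by move=> x _; rewrite lee_fin normal_pdf_ge0.
- by rewrite lee_fin mulr_ge0// exprn_ge0// ltW.
Qed.

Context {d : measure_display} {T : measurableType d} (P : probability T R).

Lemma normal_moment4_le (X : T -> R) (s : R) : 0 < s -> measurable_fun [set: T] X ->
  (forall A, measurable A -> P (X @^-1` A) = normal_prob 0 s A) ->
  (\int[P]_w (`|X w| ^+ 4)%:E <= (30 * s ^+ 4)%:E)%E.
Proof.
move=> s0 mX lawX.
have mf : measurable_fun [set: measurableTypeR R] (fun x : R => (`|x| ^+ 4)%:E).
  by apply/measurable_EFinP; apply: measurable_funX; exact: normr_measurable.
apply: le_trans (normal_prob_moment4_le s0).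
pose X' : {mfun T >-> measurableTypeR R} :=
  HB.pack X (@isMeasurableFun.Build _ _ T (measurableTypeR R) X mX).
have -> : (\int[normal_prob 0 s]_x (`|x| ^+ 4)%:E = \int[pushforward P X']_x (`|x| ^+ 4)%:E)%E.
  by apply: (eq_measure_integral (pushforward P X')) => A mA _; exact: esym (lawX A mA).
by rewrite ge0_integral_pushforward.
Qed.

End NormalMoment.

(** * Mean of the dyadic energy of a Brownian path *)

Section BrownianEnergy.
Context {R : realType}.

Lemma geometric_sum_le (z : R) N : 0 <= z -> z < 1 -> \sum_(0 <= n < N) z ^+ n <= (1 - z)^-1.
Proof.
move=> z0 z1; have z1' : 0 < 1 - z by rewrite subr_gt0.
rewrite -(ler_pM2l z1') divff ?gt_eqF//.
suff -> : (1 - z) * \sum_(0 <= n < N) z ^+ n = 1 - z ^+ N by rewrite lerBlDr lerDl exprn_ge0.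
elim: N => [|N IH]; first by rewrite big_geq// mulr0 expr0 subrr.
by rewrite big_nat_recr//= mulrDr IH exprS; ring.
Qed.

Lemma dyadic_energy_addl (f : R -> R) (x p q : R) :
  dyadic_energy (fun t => x + f t) p q = dyadic_energy f p q.
Proof.
apply: eq_eseriesr => n _; congr (_ * _)%:E; apply: eq_bigr => k _.
by congr (`|_| ^+ 4); ring.
Qed.

Context {d : measure_display} {T : measurableType d} (P : probability T R).
Variable B : T -> R -> R.
Hypothesis brB : standard_brownian P B.

Lemma measurable_brownian_increment s t : 0 <= s -> 0 <= t ->
  measurable_fun [set: T] (fun w => B w t - B w s).
Proof. by case: brB => _ _ mB _ _ s0 t0; apply: measurable_funB; exact: mB. Qed.

Lemma measurable_brownian_energy p q : 0 <= p -> p < q ->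
  measurable_fun [set: T] (fun w => dyadic_energy (B w) p q).
Proof.
move=> p0 pq; apply: ge0_emeasurable_sum => [n w _ _|n _].
  by rewrite lee_fin dyadic_energy_term_ge0.
apply/measurable_EFinP/measurable_funM => //; apply: measurable_sum => k.
apply: measurable_funX; apply: measurableT_comp; first exact: normr_measurable.
by apply: measurable_brownian_increment; apply: le_trans p0 _; exact: grid_ge.
Qed.

(** Level [n] has [2 ^ n] increments with fourth moment at most [30 * ((q - p) / 2 ^ n) ^ 2]; the
    weight [(125 / 64) ^ n] leaves a geometric series of ratio [125 / 128], whose sum is
    [128 / 3]. *)
Lemma brownian_energy_le p q : 0 <= p -> p < q ->
  (\int[P]_w dyadic_energy (B w) p q <= (125 * 16 * 30 * (128 / 3) * (q - p) ^+ 2)%:E)%E.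
Proof.
move=> p0 pq; have g0 n k : 0 <= grid p q n k by apply: le_trans p0 _; exact: grid_ge.
have mI n k : measurable_fun [set: T] (fun w => `|B w (grid p q n k.+1) - B w (grid p q n k)| ^+ 4).
  apply: measurable_funX; apply: measurableT_comp; first exact: normr_measurable.
  exact: measurable_brownian_increment.
rewrite integral_nneseries//; last 2 first.
- by move=> n; apply/measurable_EFinP/measurable_funM => //; apply: measurable_sum => k.
- by move=> n w _; rewrite lee_fin dyadic_energy_term_ge0.
have term n : (\int[P]_w (125 * 16 * (125 / 64) ^+ n *
     \sum_(0 <= k < 2 ^ n) `|B w (grid p q n k.+1) - B w (grid p q n k)| ^+ 4)%:E <=
     (125 * 16 * 30 * (q - p) ^+ 2 * (125 / 128) ^+ n)%:E)%E.
  under eq_integral do rewrite EFinM -sumEFin.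
  have mI' k : measurable_fun [set: T]
    (fun w => (`|B w (grid p q n k.+1) - B w (grid p q n k)| ^+ 4)%:E).
    exact/measurable_EFinP.
  rewrite ge0_integralZl; [|exact: measurableT|exact: emeasurable_sum| |]; last 2 first.
  - by move=> w _; apply: sume_ge0 => k _; rewrite lee_fin exprn_ge0.
  - by rewrite lee_fin; apply: mulr_ge0; rewrite ?exprn_ge0.
  rewrite ge0_integral_sum; [|exact: measurableT|exact: mI'|]; last first.
    by move=> k w _; rewrite lee_fin exprn_ge0.
  have dpos : 0 < (q - p) / 2 ^+ n by rewrite divr_gt0 ?subr_gt0 ?exprn_gt0.
  apply: (@le_trans _ _ ((125 * 16 * (125 / 64) ^+ n)%:E *
     (\sum_(0 <= k < 2 ^ n) (30 * ((q - p) / 2 ^+ n) ^+ 2)%:E))%E).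
    apply: lee_wpmul2l; first by rewrite lee_fin; apply: mulr_ge0; rewrite ?exprn_ge0.
    apply: lee_sum => k _.
    have -> : ((q - p) / 2 ^+ n) ^+ 2 = (Num.sqrt ((q - p) / 2 ^+ n)) ^+ 4.
      by rewrite (exprM _ 2 2) sqr_sqrtr// ltW.
    apply: (@normal_moment4_le _ _ _ P (fun w => B w (grid p q n k.+1) - B w (grid p q n k))).
    - by rewrite sqrtr_gt0.
    - exact: measurable_brownian_increment.
    - move=> A mA; case: brB => _ _ _ lawB _.
      by rewrite -(gridS p q n k) lawB// ltr_grid.
  rewrite sumEFin -EFinM lee_fin big_const_nat subn0 iter_addr_0.
  rewrite -(mulr_natr _ (2 ^ n)) natrX le_eqVlt; apply/orP; left; apply/eqP.
  rewrite !expr_div_n; have -> : (128 : R) ^+ n = 64 ^+ n * 2 ^+ n.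
    by rewrite -exprMn; congr (_ ^+ n); ring.
  by field; rewrite !expf_neq0.
apply: lime_le.
  by apply: is_cvg_nneseries => n _ _; apply: integral_ge0 => w _; rewrite lee_fin dyadic_energy_term_ge0.
apply: nearW => N.
apply: (@le_trans _ _ (\sum_(0 <= n < N) (125 * 16 * 30 * (q - p) ^+ 2 * (125 / 128) ^+ n)%:E)%E).
  by apply: lee_sum => n _; exact: term.
rewrite sumEFin lee_fin -mulr_sumr.
have -> : 125 * 16 * 30 * (128 / 3) * (q - p) ^+ 2 = 125 * 16 * 30 * (q - p) ^+ 2 * (1 - 125 / 128)^-1 by field.
apply: ler_wpM2l; first by rewrite mulr_ge0// sqr_ge0.
by apply: geometric_sum_le; lra.
Qed.

End BrownianEnergy.

(** * Measurability of the variation *)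

Section GridVariation.
Context {R : realType}.
Implicit Types (f : R -> R).

Lemma sum_norm_coarsen (G : nat -> R) (k : nat -> nat) m :
  (forall i, (i < m)%N -> (k i <= k i.+1)%N) ->
  \sum_(0 <= i < m) `|G (k i.+1) - G (k i)| <= \sum_(k 0%N <= j < k m) `|G j.+1 - G j|.
Proof.
elim: m => [|m IH] km; first by rewrite !big_geq.
have k0m : (k 0%N <= k m)%N.
  have : forall i, (i <= m)%N -> (k 0%N <= k i)%N.
    by elim=> // i IHi im; apply: leq_trans (IHi (ltnW im)) _; apply: km; exact: ltnW.
  exact.
rewrite big_nat_recr//= [leRHS](big_cat_nat (n := k m))//=; last exact: km.
apply: lerD; first by apply: IH => i im; apply: km; exact: ltnW.
by rewrite -(telescope_sumr _ (km m (ltnSn m))) ler_norm_sum.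
Qed.

Definition grid_variation f q n : R :=
  \sum_(0 <= k < 2 ^ n) `|f (grid 0 q n k.+1) - f (grid 0 q n k)|.

Lemma grid_variation_le f q n : 0 < q ->
  ((grid_variation f q n)%:E <= total_variation 0 q f)%E.
Proof.
move=> q0; have -> : total_variation 0 q f =
  total_variation (grid 0 q n 0) (grid 0 q n (2 ^ n)) f by rewrite grid0 gridE.
rewrite (@total_variation_sum _ f (grid 0 q n)) => [|i _]; last by rewrite ler_grid.
rewrite -sumEFin; apply: lee_sum => k _; apply: total_variation_ge.
by rewrite ler_grid.
Qed.

(** For [t < q] the grid point lies strictly to the right of [t], as the punctured filter of right
    limits demands; the cap makes it exactly [q] for [t = q]. *)
Definition grid_index (q : R) n (t : R) : nat :=
  minn (2 ^ n) (Num.truncn (t / q * 2 ^+ n)).+1.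

Lemma grid_index_le q n t : (grid_index q n t <= 2 ^ n)%N.
Proof. exact: geq_minl. Qed.

Lemma grid_index_mono q n t u : 0 < q -> t <= u -> (grid_index q n t <= grid_index q n u)%N.
Proof.
move=> q0 tu; rewrite /grid_index leq_min geq_minl /=; apply: leq_trans (geq_minr _ _) _.
by rewrite ltnS le_truncn// ler_wpM2r ?exprn_ge0// ler_wpM2r// invr_ge0 ltW.
Qed.

Lemma grid_index_end q n : 0 < q -> grid 0 q n (grid_index q n q) = q.
Proof.
move=> q0; rewrite /grid_index divff ?gt_eqF// mul1r -natrX.
rewrite (minn_idPl _) ?gridE//; apply: ltnW.
by rewrite -(ltr_nat R) truncnS_gt.
Qed.

Lemma grid_index_itv q n t : 0 <= t -> t < q ->
  t < grid 0 q n (grid_index q n t) /\ grid 0 q n (grid_index q n t) <= t + q / 2 ^+ n.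
Proof.
move=> t0 tq; have q0 : 0 < q by exact: le_lt_trans tq.
have n0 : 0 < 2 ^+ n :> R by rewrite exprn_gt0.
have z0 : 0 <= t / q * 2 ^+ n by rewrite mulr_ge0 ?exprn_ge0// divr_ge0// ltW.
have /andP[a1 a2] := truncn_itv z0; set k := Num.truncn _ in a1 a2 *.
have tE : t = q * ((t / q * 2 ^+ n) / 2 ^+ n) by field; rewrite !gt_eqF.
have gk : t < grid 0 q n k.+1.
  rewrite /grid add0r subr0 {1}tE ltr_pM2l// ltr_pM2r ?invr_gt0//.
have gk' : grid 0 q n k.+1 <= t + q / 2 ^+ n.
  rewrite /grid add0r subr0 {1}tE.
  have -> : q * (t / q * 2 ^+ n / 2 ^+ n) + q / 2 ^+ n = q * ((t / q * 2 ^+ n + 1) / 2 ^+ n).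
    by ring.
  by rewrite ler_pM2l// ler_pM2r ?invr_gt0// -natr1 lerD2r.
rewrite /grid_index -/k; case: (leqP (2 ^ n) k.+1) => h; last by split.
by rewrite gridE; split=> //; apply: le_trans gk'; rewrite -{1}(gridE 0 q n) ler_grid.
Qed.

Lemma grid_index_cvg f q t : 0 <= t -> t <= q -> 0 < q -> f u @[u --> t^'+] --> f t ->
  f (grid 0 q n (grid_index q n t)) @[n --> \oo] --> f t.
Proof.
move=> t0; rewrite le_eqVlt => /predU1P[-> q0 _|tq q0 /cvgrPdist_lt ft].
  by under eq_cvg do rewrite grid_index_end//; exact: cvg_cst.
apply/cvgrPdist_lt => e e0; have /near_rightP[d d0 hd] := ft e e0.
near=> n; have [g1 g2] := grid_index_itv n t0 tq.
apply: hd => //; apply: (le_lt_trans g2); rewrite ltrD2l.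
rewrite ltr_pdivrMr ?exprn_gt0// mulrC -ltr_pdivrMr//.
apply: (lt_le_trans (truncnS_gt (q / d))); rewrite -natrX ler_nat.
apply: (@leq_trans n); last exact: ltnW (ltn_expl _ _).
by near: n; exists (Num.truncn (q / d)).+1.
Unshelve. all: by end_near.
Qed.

(** Move each node of a partition to its grid point on the right. By right continuity the variation
    along the moved nodes converges to that of the partition, and by the triangle inequality it
    never exceeds the grid variation. The result is a countable supremum, which preserves
    measurability. *)
Lemma total_variation_grid f q : 0 < q ->
  (forall t, 0 <= t -> f u @[u --> t^'+] --> f t) ->
  total_variation 0 q f = ereal_sup (range (fun n => (grid_variation f q n)%:E)).
Proof.
move=> q0 fr; apply/eqP; rewrite eq_le; apply/andP; split; last first.
  by apply: ge_ereal_sup => _ [n _ <-]; exact: grid_variation_le.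
apply: ge_ereal_sup => _ [_ [s ps <-] <-].
pose u i := nth q (0 :: s) i.
have u0 i : (i <= size s)%N -> 0 <= u i by move=> i_s; exact: itv_partition_nth_ge ps.
have uq i : (i <= size s)%N -> u i <= q by move=> i_s; exact: itv_partition_nth_le ps.
have uS i : (i < size s)%N -> u i <= u i.+1.
  by move=> i_s; case: ps => /(pathP q)/(_ _ i_s) /ltW.
have cv : (\sum_(0 <= i < size s) `|f (grid 0 q n (grid_index q n (u i.+1)))
     - f (grid 0 q n (grid_index q n (u i)))|) @[n --> \oo] --> variation 0 q f s.
  rewrite /variation /= big_mkord; under eq_cvg do rewrite big_mkord.
  apply: cvg_big => [|i _]; first exact: add_continuous.
  have i_s : (i < size s)%N by exact: ltn_ord.
  apply: cvg_norm; apply: cvgB; apply: grid_index_cvg => //.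
  - exact: u0.
  - exact: uq.
  - by apply: fr; exact: u0.
  - exact/u0/ltnW.
  - exact/uq/ltnW.
  - by apply: fr; exact/u0/ltnW.
have cvE : (\sum_(0 <= i < size s) `|f (grid 0 q n (grid_index q n (u i.+1)))
     - f (grid 0 q n (grid_index q n (u i)))|)%:E @[n --> \oo] --> (variation 0 q f s)%:E.
  by apply: cvg_EFin => //; exact: nearW.
rewrite -(cvg_lim _ cvE)//; apply: lime_le; first by apply/cvg_ex; eexists; exact: cvE.
apply: nearW => n; apply: le_trans (ereal_sup_ubound _); last by exists n.
rewrite lee_fin /grid_variation.
apply: le_trans (@sum_norm_coarsen (f \o grid 0 q n) (fun i => grid_index q n (u i)) (size s) _) _.
  by move=> i i_s; apply: grid_index_mono => //; exact: uS.
have a1 := grid_index_le q n (u (size s)).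
rewrite [leRHS](big_cat_nat (n := grid_index q n (u 0%N)))//=; last exact: grid_index_le.
rewrite [X in _ + X](big_cat_nat (n := grid_index q n (u (size s))))//=; last first.
  have : forall i, (i <= size s)%N -> u 0%N <= u i.
    by elim=> // i IHi im; apply: le_trans (IHi (ltnW im)) _; exact: uS.
  by move=> /(_ _ (leqnn _)); exact: grid_index_mono.
rewrite addrCA lerDl; apply: addr_ge0; exact: sumr_ge0.
Qed.

Lemma eq_total_variation f g p q : (forall t, p <= t -> t <= q -> f t = g t) ->
  total_variation p q f = total_variation p q g.
Proof.
move=> fg.
have vE s : itv_partition p q s -> variation p q f s = variation p q g s.
  move=> ps; apply: eq_big_nat => i /andP[_ i_s] /=.
  rewrite !fg//; [exact: itv_partition_nth_ge (ltnW i_s) ps|exact: itv_partition_nth_le (ltnW i_s) ps|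
    exact: (itv_partition_nth_ge (m := i.+1) i_s ps)|exact: (itv_partition_nth_le (m := i.+1) i_s ps)].
congr ereal_sup; apply/seteqP; split=> _ [_ [s ps <-] <-]; rewrite ?vE// -?vE//;
  by eexists; [exact: variations_variation ps|rewrite ?vE].
Qed.

End GridVariation.

(** * Measurability of the constraining term at a fixed time *)

Section MeasurableSolution.
Context {R : realType}.
Implicit Types (l r : R -> \bar R) (psi phi eta : R -> R).

Lemma near_lte (F : set_system R) {FF : Filter F} (h : R -> R) (g : R -> \bar R)
    (h0 : R) (g0 : \bar R) :
  h u @[u --> F] --> h0 -> g u @[u --> F] --> g0 -> (h0%:E < g0)%E ->
  \forall u \near F, ((h u)%:E < g u)%E.
Proof.
move=> hh gg hg; have [y hy yg] : exists2 y, h0 < y & (y%:E < g0)%E.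
  case: g0 hg {gg} => [z| |]//; last by move=> _; exists (h0 + 1); [rewrite ltrDl|rewrite ltry].
  rewrite lte_fin => hz; exists ((h0 + z) / 2); rewrite ?lte_fin; lra.
have nh : \forall u \near F, h u < y by exact: cvgr_lt hh _ hy.
have ng : \forall u \near F, (y%:E < g u)%E.
  have A : nbhs g0 [set z | (y%:E < z)%E].
    by apply: open_nbhs_nbhs; split=> //; exact: open_ereal_gt_ereal.
  exact: gg A.
near=> u; apply: (@lt_trans _ _ y%:E).
  by rewrite lte_fin; near: u.
by near: u.
Unshelve. all: by end_near.
Qed.

Lemma near_gte (F : set_system R) {FF : Filter F} (h : R -> R) (g : R -> \bar R)
    (h0 : R) (g0 : \bar R) :
  h u @[u --> F] --> h0 -> g u @[u --> F] --> g0 -> (g0 < h0%:E)%E ->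
  \forall u \near F, (g u < (h u)%:E)%E.
Proof.
move=> hh gg hg.
have := @near_lte F FF (\- h) (fun u => - g u)%E (- h0) (- g0)%E (cvgN hh) (cvgeN gg).
rewrite EFinN lteN2 => /(_ FF FF hg); apply: filterS => u /=.
by rewrite EFinN lteN2.
Qed.

(** Rationals clipped to [[0, t]]. The end point [t] is listed separately, since right continuity
    cannot reach it from within [[0, t]]. *)
Definition dense_time (t : R) (n : nat) : R :=
  if n is n'.+1 then
    if (unpickle n' : option rat) is Some q then Num.max 0 (Num.min t (ratr q)) else t
  else t.

Lemma dense_time_itv t n : 0 <= t -> 0 <= dense_time t n <= t.
Proof.
move=> t0; case: n => [|n] /=; first by rewrite t0 lexx.
case: unpickle => [q|]; last by rewrite t0 lexx.
by rewrite le_max lexx ge_max t0 ge_min lexx.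
Qed.

Lemma dense_time_itvoo t u v : 0 <= u -> u < v -> v <= t ->
  exists n, u < dense_time t n /\ dense_time t n < v.
Proof.
move=> u0 uv vt; have [q] := rat_in_itvoo uv; rewrite in_itv /= => /andP[uq qv].
exists (pickle q).+1; rewrite /dense_time pickleK.
have zt : ratr q <= t := ltW (lt_le_trans qv vt).
have z0 : 0 <= ratr q :> R := ltW (le_lt_trans u0 uq).
by rewrite (min_idPr zt) (max_idPr z0).
Qed.

(* An event depending on countably many times which is implied by [eta t < - c] and implies
   [eta t <= - c]; it is read off the explicit formula for the constraining term. *)
Definition pushed_below l r psi (t c : R) : Prop :=
  (exists n, (r (dense_time t n) < (psi (dense_time t n) - c)%:E)%E /\
    forall k, dense_time t n <= dense_time t k ->
      (l (dense_time t k) <= (psi (dense_time t k) - c)%:E)%E) \/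
  (c < 0 /\ forall k, (l (dense_time t k) <= (psi (dense_time t k) - c)%:E)%E).

Lemma le_dense_time l psi s t c : cadlag l -> {within [set t : R | 0 <= t], continuous psi} ->
  0 <= s ->
  (forall k, s <= dense_time t k -> (l (dense_time t k) <= (psi (dense_time t k) - c)%:E)%E) ->
  forall u, s <= u -> u <= t -> (l u <= (psi u - c)%:E)%E.
Proof.
move=> [lc _] pc s0 hl u su; have u0 : 0 <= u by exact: le_trans su.
rewrite le_eqVlt => /predU1P[ut|ut]; first by have := hl 0%N; rewrite /= -ut; apply.
rewrite leNgt; apply/negP => lu.
have cp : (psi v - c) @[v --> u^'+] --> psi u - c.
  by apply: cvgB; [exact: within_ge0_at_right|exact: cvg_cst].
have /near_rightP[e e0 he] : \forall v \near u^'+, ((psi v - c)%:E < l v)%E.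
  exact: near_lte cp (lc u u0) lu.
have mt : Num.min (u + e) t <= t by rewrite ge_min lexx orbT.
have um : u < Num.min (u + e) t by rewrite lt_min ut ltrDl e0.
have [n [un nm]] := dense_time_itvoo u0 um mt.
have := he _ un (lt_le_trans nm _); rewrite ge_min lexx => /(_ isT).
by rewrite ltNge hl// (le_trans su)// ltW.
Qed.

(** Once [eta <= - c], it stays so as long as [l <= psi - c]: wherever the lower barrier is active,
    [phi <= l] gives [eta <= - c] again. The starting point is a time where [phi <= r < psi - c], or
    else time 0, where [eta (0-) = 0 < - c]. *)
Lemma pushed_below_le l r psi phi eta t c : ESP l r psi phi eta -> cadlag l ->
  {within [set t : R | 0 <= t], continuous psi} -> 0 <= t ->
  pushed_below l r psi t c -> eta t <= - c.
Proof.
move=> H lc pc t0; have [_ ecad E1 _ E3] := H.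
have key s : 0 <= s -> s <= t -> eta s <= - c ->
    (forall u, s <= u -> u <= t -> (l u <= (psi u - c)%:E)%E) -> eta t <= - c.
  move=> s0 st es hl.
  have [[u [su ut pu hu]]|[s' [_ _ es' ee]]] := last_passage H ecad (fun t _ h => h) s0 st es.
    have := le_trans pu (hl u (ltW su) ut); rewrite lee_fin.
    have [-> _] := E1 u (le_trans s0 (ltW su)).
    by have := hu u (lexx u) ut; lra.
  exact: le_trans ee es'.
case=> [[n [rn hl]]|[c0 hl]].
  have /andP[n0 nt] := dense_time_itv n t0.
  apply: (key _ n0 nt); last exact: (le_dense_time lc pc n0 hl).
  have [e /andP[_ pr]] := E1 _ n0.
  by have := le_lt_trans pr rn; rewrite lte_fin e; lra.
have hl' : forall u, 0 <= u -> u <= t -> (l u <= (psi u - c)%:E)%E.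
  by apply: le_dense_time => // k _; exact: hl.
apply: (key 0) => //; rewrite leNgt; apply/negP => ec.
have [e _] := E1 0 (lexx 0).
have [_] := E3 0 (lexx 0); rewrite /leftlim0 eqxx => h0.
have : eta 0 <= 0.
  by apply: h0; apply: le_lt_trans (hl' 0 (lexx 0) t0) _; rewrite lte_fin e; lra.
lra.
Qed.

(** Look back to the last time with [- c <= eta]: afterwards the upper barrier is active at some
    [u], so [r u < psi u - c], which persists to the right of [u] and so reaches a listed time. If
    there is no such time, either the upper barrier is already active at 0, or condition (3) gives
    [0 <= eta 0 < - c]. *)
Lemma lt_pushed_below l r psi phi eta t c : ESP l r psi phi eta -> cadlag r ->
  {within [set t : R | 0 <= t], continuous psi} -> 0 <= t ->
  eta t < - c -> pushed_below l r psi t c.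
Proof.
move=> H [rc _] pc t0 etc; have [_ ecad E1 _ E3] := H.
have lE u : 0 <= u -> eta u < - c -> (l u <= (psi u - c)%:E)%E.
  move=> u0 eu; have [e /andP[pl _]] := E1 u u0; apply: le_trans pl _.
  by rewrite lee_fin e; lra.
have key u : 0 <= u -> u <= t -> (r u <= (phi u)%:E)%E ->
    (forall v, u <= v -> v <= t -> eta v < - c) -> pushed_below l r psi t c.
  move=> u0 ut ru hv.
  have ru' : (r u < (psi u - c)%:E)%E.
    by apply: le_lt_trans ru _; have [-> _] := E1 u u0; have := hv u (lexx u) ut; rewrite lte_fin; lra.
  left; suff [n [un rn]] : exists n, u <= dense_time t n /\ (r (dense_time t n) < (psi (dense_time t n) - c)%:E)%E.
    exists n; split=> // k nk; have /andP[k0 kt] := dense_time_itv k t0.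
    by apply: lE => //; apply: hv => //; exact: le_trans nk.
  move: ut; rewrite le_eqVlt => /predU1P[ut|ut]; first by exists 0%N; rewrite /= -ut.
  have cp : (psi v - c) @[v --> u^'+] --> psi u - c.
    by apply: cvgB; [exact: within_ge0_at_right|exact: cvg_cst].
  have /near_rightP[e e0 he] : \forall v \near u^'+, (r v < (psi v - c)%:E)%E.
    exact: near_gte cp (rc u u0) ru'.
  have mt : Num.min (u + e) t <= t by rewrite ge_min lexx orbT.
  have um : u < Num.min (u + e) t by rewrite lt_min ut ltrDl e0.
  have [n [un nm]] := dense_time_itvoo u0 um mt.
  exists n; split; first exact: ltW.
  by apply: he => //; apply: lt_le_trans nm _; rewrite ge_min lexx.
have [[s [s0 st es]]|nos] := pselect (exists s, [/\ 0 <= s, s <= t & - c <= eta s]).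
  have es' : (\- eta) s <= c by rewrite /= lerNl.
  have [[u [su ut pu hu]]|[s' [ss' s't es'' ee]]] :=
      last_passage (ESP_opp H) (cadlagN ecad) (fun t _ h => h) s0 st es'.
    apply: (key u) => //; first exact: le_trans (ltW su).
      by move: pu; rewrite /= EFinN leeN2.
    by move=> v uv vt; have := hu v uv vt; rewrite /= ltrNr.
  by move: es'' ee etc => /=; lra.
have all_lt v : 0 <= v -> v <= t -> eta v < - c.
  by move=> v0 vt; rewrite ltNge; apply/negP => ev; apply: nos; exists v.
have [r0|r0] := leP (r 0) (phi 0)%:E; first exact: (key 0).
right; have [+ _] := E3 0 (lexx 0); rewrite /leftlim0 eqxx => /(_ r0) e0.
split; first by have := all_lt 0 (lexx 0) t0; lra.
move=> k; have /andP[k0 kt] := dense_time_itv k t0.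
by apply: lE => //; exact: all_lt.
Qed.

Context {d : measure_display} {T : measurableType d}.

Lemma measurable_pushed_below l r (psi : T -> R -> R) t c :
  (forall u, 0 <= u -> measurable_fun [set: T] (psi ^~ u)) -> 0 <= t ->
  measurable [set w | pushed_below l r (psi w) t c].
Proof.
move=> mpsi t0.
have mle k : measurable [set w | (l (dense_time t k) <= (psi w (dense_time t k) - c)%:E)%E].
  have /andP[k0 _] := dense_time_itv k t0.
  rewrite -[X in measurable X]setTI; apply: emeasurable_fun_c_infty => //.
  by apply/measurable_EFinP; apply: measurable_funB => //; exact: mpsi.
have mlt k : measurable [set w | (r (dense_time t k) < (psi w (dense_time t k) - c)%:E)%E].
  have /andP[k0 _] := dense_time_itv k t0.
  rewrite -[X in measurable X]setTI; apply: emeasurable_fun_o_infty => //.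
  by apply/measurable_EFinP; apply: measurable_funB => //; exact: mpsi.
apply: measurableU.
  rewrite [X in measurable X](_ : _ = \bigcup_n (
    [set w | (r (dense_time t n) < (psi w (dense_time t n) - c)%:E)%E] `&`
    \bigcap_(k in [set k | dense_time t n <= dense_time t k])
      [set w | (l (dense_time t k) <= (psi w (dense_time t k) - c)%:E)%E])).
    apply: bigcup_measurable => n _; apply: measurableI => //.
    by apply: bigcap_measurableType.
  by apply/seteqP; split=> w /= => [[n [h1 h2]]|[n _ [h1 h2]]]; exists n.
have [c0|c0] := ltP c 0.
  rewrite [X in measurable X](_ : _ = \bigcap_k
      [set w | (l (dense_time t k) <= (psi w (dense_time t k) - c)%:E)%E]).
    by apply: bigcapT_measurable.
  apply/seteqP; split=> w /= => [[_ h] k _|h]; first exact: h.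
  by split=> // k; exact: h.
by rewrite [X in measurable X](_ : _ = set0)//; apply/seteqP; split=> w //= -[].
Qed.

Lemma measurable_ESP_eta l r (psi phi eta : T -> R -> R) t :
  (forall w, ESP l r (psi w) (phi w) (eta w)) -> cadlag l -> cadlag r ->
  (forall w, {within [set t : R | 0 <= t], continuous (psi w)}) ->
  (forall u, 0 <= u -> measurable_fun [set: T] (psi ^~ u)) -> 0 <= t ->
  measurable_fun [set: T] (eta ^~ t).
Proof.
move=> H lc rc pc mpsi t0.
apply: (measurability (@RGenInftyO.G R) (RGenInftyO.measurableE R)) => _ [_ [y ->] <-].
(* The shift by [n.+1%:R^-1] absorbs the gap between the strict and the weak inequality in the two
   comparisons with [pushed_below]. *)
rewrite setTI [X in measurable X](_ : _ =
    \bigcup_n [set w | pushed_below l r (psi w) t (- y + n.+1%:R^-1)]).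
  by apply: bigcup_measurable => n _; exact: measurable_pushed_below.
apply/seteqP; split=> w /=; rewrite in_itv /=.
  move=> ey; have d0 : 0 < y - eta w t by rewrite subr_gt0.
  exists (Num.truncn (y - eta w t)^-1) => //.
  apply: (lt_pushed_below (H w) rc (pc w) t0).
  have := truncnS_gt (y - eta w t)^-1; set n := (Num.truncn _).+1 => hn.
  have : n%:R^-1 < y - eta w t.
    by rewrite -[ltRHS]invrK ltf_pV2// posrE ?invr_gt0// ltr0n.
  lra.
move=> [n _ /(pushed_below_le (H w) lc (pc w) t0)].
have : 0 < n.+1%:R^-1 :> R by rewrite invr_gt0.
by move: (n.+1%:R^-1) => z; lra.
Qed.

Lemma measurable_ESP_total_variation l r (psi phi eta : T -> R -> R) q :
  (forall w, ESP l r (psi w) (phi w) (eta w)) -> cadlag l -> cadlag r ->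
  (forall w, {within [set t : R | 0 <= t], continuous (psi w)}) ->
  (forall u, 0 <= u -> measurable_fun [set: T] (psi ^~ u)) -> 0 < q ->
  measurable_fun [set: T] (fun w => total_variation 0 q (eta w) : \bar R).
Proof.
move=> H lc rc pc mpsi q0.
rewrite (_ : (fun w => _) = fun w => esups (fun n => (grid_variation (eta w) q n)%:E) 0%N); last first.
  apply/funext => w; rewrite total_variation_grid//; last by case: (H w) => _ [].
  congr ereal_sup; apply/seteqP; split => _ [n _ <-]; by exists n.
apply: (@measurable_fun_esups _ _ _ _ (fun n w => (grid_variation (eta w) q n)%:E)) => n.
apply/measurable_EFinP; apply: measurable_sum => k; apply: measurableT_comp; first exact: normr_measurable.
by apply: measurable_funB; apply: (measurable_ESP_eta H) => //; exact: grid_ge.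
Qed.

End MeasurableSolution.

(** * Summation over the intervals *)

Section TwoSidedSums.
Context {R : realType}.

Lemma nneseries_int_lty (u : int -> \bar R) : (forall k, (0 <= u k)%E) ->
  (\esum_(k in [set: int]) u k < +oo)%E ->
  (\sum_(0 <= n <oo) (u n%:Z + u (- n.+1%:Z)%R) < +oo)%E.
Proof.
move=> u0 fu; have sub (e : nat -> int) : injective e ->
    (\sum_(0 <= n <oo) u (e n) < +oo)%E.
  move=> einj; apply: le_lt_trans fu.
  rewrite nneseries_esum => [|n _]; last exact: u0.
  rewrite -(@esum_image _ _ _ _ e u); last by move=> i j _ _; exact: einj.
  rewrite esum_mkcond; apply: le_esum => k _; case: ifP => // _; exact: u0.
rewrite nneseriesD => [|n _ _|n _ _]; [|exact: u0|exact: u0].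
by apply: lte_add_pinfty; [apply: (sub Posz) => i j []|apply: (sub (fun n => - n.+1%:Z)) => i j; lia].
Qed.

Variable s : int -> R.
Hypothesis s_lt : forall k, s k < s (k + 1).

Lemma int_seq_le k (n : nat) : s k <= s (k + n%:Z).
Proof.
elim: n => [|n IH]; first by rewrite addr0.
by apply: le_trans IH _; rewrite -addn1 PoszD addrA ltW.
Qed.

Lemma int_seq_homo i j : (i <= j)%R -> s i <= s j.
Proof.
move=> ij; have -> : j = i + (absz (j - i))%:Z by lia.
exact: int_seq_le.
Qed.

Lemma int_seq_gt0 k : s (- n%:Z) @[n --> \oo] --> 0 -> 0 < s k.
Proof.
move=> s0; apply: le_lt_trans (_ : 0 <= s (k - 1)) _; last by have := s_lt (k - 1); rewrite subrK.
rewrite -(cvg_lim _ s0)//; apply: limr_le; first by apply/cvg_ex; exists 0.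
exists (absz (k - 1)) => // n /= hn; apply: int_seq_homo; lia.
Qed.

Lemma int_seq_lt_lim k tau : s n%:Z @[n --> \oo] --> tau -> s k < tau.
Proof.
move=> st; apply: lt_le_trans (s_lt k) _.
rewrite -(cvg_lim _ st)//; apply: limr_ge; first by apply/cvg_ex; exists tau.
exists (absz (k + 1)) => // n /= hn; apply: int_seq_homo; lia.
Qed.

(** Pairing [n] with [- n.+1] follows the growth of the interval by one piece at each end, and the
    pairs exhaust the integers. *)
Lemma total_variation_int_sum (f : R -> R) N :
  (total_variation (s (- N%:Z)%R) (s N%:Z) f = \sum_(0 <= n < N)
    (total_variation (s n%:Z) (s (n%:Z + 1)%R) f +
     total_variation (s (- n.+1%:Z)%R) (s (- n.+1%:Z + 1)%R) f))%E.
Proof.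
elim: N => [|N IH]; first by rewrite oppr0 total_variationxx big_geq.
rewrite big_nat_recr//= -IH.
have e1 : N.+1%:Z = N%:Z + 1 by lia.
have e2 : - N.+1%:Z + 1 = - N%:Z by lia.
have h1 : s (- N.+1%:Z) <= s (- N%:Z) by rewrite -e2 ltW.
have h2 : s (- N%:Z) <= s N%:Z by apply: int_seq_homo; lia.
have h3 : s N%:Z <= s (N%:Z + 1) by exact: ltW.
rewrite e2 {2}e1 (@total_variationD _ _ _ (s (- N%:Z)))//; last exact: le_trans h3.
by rewrite (@total_variationD _ (s (- N%:Z)) _ (s N%:Z))// addeC addeA.
Qed.

Lemma total_variation_two_sided (f : R -> R) (u : int -> \bar R) tau L :
  s (- n%:Z) @[n --> \oo] --> 0 -> s n%:Z @[n --> \oo] --> tau ->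
  (forall k, (0 <= u k)%E) ->
  (forall k, (total_variation (s k) (s (k + 1)%R) f <= u k)%E) ->
  f t @[t --> 0^'+] --> f 0 -> f t @[t --> tau^'-] --> L ->
  (total_variation 0 tau f <=
    \sum_(0 <= n <oo) (u n%:Z + u (- n.+1%:Z)%R) + `|f tau - L|%:E)%E.
Proof.
move=> s0 st u0 fu f0 fL; set S := (\sum_(0 <= n <oo) _)%E.
have tau0 : 0 < tau by exact: lt_trans (int_seq_gt0 0 s0) (int_seq_lt_lim 0 st).
have := @total_variation_right_limit _ f 0 tau (S + `|f tau - L|%:E)%E (f 0) tau0 _ f0.
rewrite subrr normr0 adde0; apply=> p p0 pt.
move: pt; rewrite le_eqVlt => /predU1P[->|pt].
  rewrite total_variationxx; apply: adde_ge0; last by rewrite lee_fin.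
  by apply: nneseries_ge0 => n _ _; rewrite adde_ge0.
apply: total_variation_left_limit pt _ fL => q pq qt.
have [N1 hN1] : exists N1, forall n, (N1 <= n)%N -> s (- n%:Z) < p.
  by have [N1 _ h] := cvgr_lt _ s0 _ p0; exists N1.
have [N2 hN2] : exists N2, forall n, (N2 <= n)%N -> q < s n%:Z.
  by have [N2 _ h] := cvgr_gt _ st _ qt; exists N2.
set N := maxn N1 N2.
have h1 := hN1 _ (leq_maxl N1 N2); have h2 := hN2 _ (leq_maxr N1 N2).
apply: (le_trans (le_total_variation f (ltW h1) pq (ltW h2))).
rewrite total_variation_int_sum.
apply: (@le_trans _ _ (\sum_(0 <= n < N) (u n%:Z + u (- n.+1%:Z)%R))%E).
  by apply: lee_sum => n _; exact: leeD.
by apply: nneseries_lim_ge => n _ _; rewrite adde_ge0.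
Qed.

End TwoSidedSums.

(** * The barriers around the band and at the terminal time *)

Section BarrierBounds.
Context {R : realType}.

Lemma lee_of_itv_lt (z : \bar R) (a b : R) : a < b ->
  (forall y, a < y -> y < b -> (z < y%:E)%E) -> (z <= a%:E)%E.
Proof.
move=> ab h; rewrite leNgt; apply/negP => az.
have [y ay yz] : exists2 y, a < y & (y%:E < z)%E.
  case: z az {h} => [z| |]//; last by move=> _; exists (a + 1); [rewrite ltrDl|rewrite ltry].
  by rewrite lte_fin => az; exists ((a + z) / 2); rewrite ?lte_fin; lra.
have := h (Num.min y ((a + b) / 2)); rewrite lt_min ay gt_min.
have -> : a < (a + b) / 2 by lra.
have -> : (a + b) / 2 < b by lra.
rewrite orbT => /(_ isT isT) zy; have := lt_trans yz zy.
by rewrite lte_fin lt_min ltxx.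
Qed.

Lemma gee_of_itv_lt (z : \bar R) (a b : R) : a < b ->
  (forall y, a < y -> y < b -> (y%:E < z)%E) -> (b%:E <= z)%E.
Proof.
move=> ab h; have ab' : - b < - a by rewrite ltrN2.
have := @lee_of_itv_lt (- z)%E _ _ ab'; rewrite EFinN leeN2; apply=> y y1 y2.
by have := h (- y); rewrite EFinN -lteN2 oppeK; apply; lra.
Qed.

(* At a jump one of the barriers is attained, so that [phi tau] is the value of that barrier;
   an infinite barrier, whose [fine] is the junk value [0], is never attained. *)
Lemma ESP_jump_le (l r : R -> \bar R) psi phi eta (tau M : R) (s : nat -> R) :
  ESP l r psi phi eta -> {within [set t : R | 0 <= t], continuous psi} -> 0 < tau ->
  (forall n, s n < tau) -> s n @[n --> \oo] --> tau ->
  (\forall n \near \oo, `|phi (s n)| <= M) ->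
  `|eta tau - (leftlim phi tau - psi tau)| <= `|fine (l tau)| + `|fine (r tau)| + M.
Proof.
move=> H pc tau0 st sc bM; have [[_ pl] _ E1 _ E3] := H.
have cs : phi (s n) @[n --> \oo] --> leftlim phi tau.
  by move/cvg_at_leftP : (pl _ tau0); apply.
have LM : `|leftlim phi tau| <= M.
  rewrite -(cvg_lim _ (cvg_norm cs))//; apply: limr_le => //.
  by apply/cvg_ex; exists `|leftlim phi tau|; exact: cvg_norm.
have M0 : 0 <= M by exact: le_trans LM.
have eL : leftlim0 eta tau = leftlim phi tau - psi tau.
  rewrite /leftlim0 gt_eqF//; apply/cvg_lim => //; exact: ESP_eta_cvg_left H pc tau0.
have [e /andP[lp pr]] := E1 _ (ltW tau0); have [e1 e2] := E3 _ (ltW tau0).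
have jE : eta tau - (leftlim phi tau - psi tau) = phi tau - leftlim phi tau by rewrite e; ring.
have [j0|j0|j0] := ltgtP (eta tau) (leftlim phi tau - psi tau); last first.
- by rewrite j0 subrr normr0 !addr_ge0.
- have pl' : l tau = (phi tau)%:E.
    apply/eqP; rewrite eq_le lp /= leNgt; apply/negP => /e2; rewrite eL; lra.
  rewrite jE pl' /=; apply: le_trans (ler_normB _ _) _.
  by have := normr_ge0 (fine (r tau)); lra.
- have pr' : r tau = (phi tau)%:E.
    apply/eqP; rewrite eq_le pr andbT leNgt; apply/negP => /e1; rewrite eL; lra.
  rewrite jE pr' /=; apply: le_trans (ler_normB _ _) _.
  by have := normr_ge0 (fine (l tau)); lra.
Qed.

End BarrierBounds.

Section ExpectedVariation.
Context {R : realType}.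

Lemma nneseries_lin_lty (u v z : nat -> \bar R) (c : R) :
  (forall n, 0 <= u n)%E -> (forall n, 0 <= v n)%E -> (forall n, 0 <= z n)%E -> 0 <= c ->
  (\sum_(0 <= n <oo) u n < +oo)%E -> (\sum_(0 <= n <oo) v n < +oo)%E ->
  (\sum_(0 <= n <oo) z n < +oo)%E ->
  (\sum_(0 <= n <oo) (u n + (v n + v n) + c%:E * z n) < +oo)%E.
Proof.
move=> u0 v0 z0 c0 fu fv fz.
have cz0 n : (0 <= c%:E * z n)%E by apply: mule_ge0.
have vv0 n : (0 <= v n + v n)%E by apply: adde_ge0.
rewrite nneseriesD => [|n _ _|n _ _] //; last exact: adde_ge0.
rewrite nneseriesD => [|n _ _|n _ _] //.
rewrite nneseriesD => [|n _ _|n _ _] //.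
rewrite nneseriesZl => [|n _] //.
by rewrite !lte_add_pinfty// lte_mul_pinfty.
Qed.

Lemma dk_ge0 (l r : R -> \bar R) s a b k : (0 <= dk l r s a b k)%E.
Proof. by rewrite adde_ge0. Qed.

Lemma dk'_ge0 (l r : R -> \bar R) s a b k : (0 <= dk' l r s a b k)%E.
Proof. by rewrite adde_ge0// le_max abse_ge0. Qed.

(* The coefficient of the energy dominates [4 / h ^ 3], where [h = (b k - a k) / 2] and hence
   [2 * c1 * h > Num.sqrt (s (k + 1) - s k)]. *)
Definition variation_bound (l r : R -> \bar R) (s a b : int -> R) (c1 : R) (f : R -> R)
    (k : int) : \bar R :=
  (dk l r s a b k + (dk' l r s a b k + dk' l r s a b k) +
   ((c1 * Num.sqrt (s (k + 1)%R - s k))%:E +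
    (32 * c1 ^+ 3 / Num.sqrt (s (k + 1)%R - s k) ^+ 3)%:E *
      dyadic_energy f (s k) (s (k + 1)%R)))%E.

Lemma variation_bound_ge0 l r s a b c1 f k : 0 < c1 ->
  (0 <= variation_bound l r s a b c1 f k)%E.
Proof.
move=> c10; have sg0 : 0 <= Num.sqrt (s (k + 1) - s k) by rewrite sqrtr_ge0.
apply: adde_ge0; first by rewrite !adde_ge0// ?dk_ge0// dk'_ge0.
apply: adde_ge0; first by rewrite lee_fin mulr_ge0// ltW.
apply: mule_ge0; last exact: dyadic_energy_ge0.
by rewrite lee_fin divr_ge0 ?exprn_ge0// mulr_ge0// exprn_ge0// ltW.
Qed.

Lemma ESP_variation_bound (l r : R -> \bar R) psi phi eta (s a b : int -> R) c1 k :
  ESP l r psi phi eta -> cadlag l -> cadlag r ->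
  {within [set t : R | 0 <= t], continuous psi} -> 0 < s k -> s k < s (k + 1) -> 0 < c1 ->
  (forall t y, s k < t -> t < s (k + 1) -> a k < y -> y < b k ->
     (l t < y%:E)%E /\ (y%:E < r t)%E) ->
  c1^-1 * Num.sqrt (s (k + 1) - s k) < b k - a k ->
  b k - a k < c1 * Num.sqrt (s (k + 1) - s k) ->
  (total_variation (s k) (s (k + 1)%R) eta <= variation_bound l r s a b c1 psi k)%E.
Proof.
move=> H lc rc pc sk0 sk c10 box ab1 ab2.
set sg := Num.sqrt _ in ab1 ab2.
have sg0 : 0 < sg by rewrite sqrtr_gt0 subr_gt0.
have ab : a k < b k by rewrite -subr_gt0; apply: lt_trans ab1; rewrite mulr_gt0// invr_gt0.
set m := midpt a b k; pose h := (b k - a k) / 2.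
have h0 : 0 < h by rewrite divr_gt0// subr_gt0.
have mh1 : m - h = a k by rewrite /m /h /midpt; field.
have mh2 : m + h = b k by rewrite /m /h /midpt; field.
have la u : s k < u -> u < s (k + 1) -> (l u <= (m - h)%:E)%E.
  by move=> u1 u2; rewrite mh1; apply: (lee_of_itv_lt ab) => y y1 y2; have [] := box u y u1 u2 y1 y2.
have rb u : s k < u -> u < s (k + 1) -> ((m + h)%:E <= r u)%E.
  by move=> u1 u2; rewrite mh2; apply: (gee_of_itv_lt ab) => y y1 y2; have [] := box u y u1 u2 y1 y2.
apply: le_trans (ESP_variation_itv H lc rc pc (ltW sk0) sk h0 la rb) _.
rewrite /variation_bound -/sg addeAC; apply: leeD.
  (* The value and the left limit at [s (k + 1)] are each below the maximum in [dk'], which is why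
     it is counted twice. *)
  apply: leeD => //; rewrite /dk'; apply: leeD.
    by apply: leeD; rewrite le_max lexx.
  by apply: leeD; rewrite le_max lexx orbT.
apply: leeD.
  by rewrite lee_fin /h; move: ab2; lra.
apply: lee_wpmul2r; first exact: dyadic_energy_ge0.
rewrite lee_fin; have hs : sg <= 2 * c1 * h.
  by rewrite /h; move: ab1; rewrite mulrC ltr_pdivrMr//; lra.
(* Cubing gives the factor 8, and [4 * 8] is the 32 of [variation_bound]. *)
have h3 : sg ^+ 3 <= 8 * c1 ^+ 3 * h ^+ 3.
  have -> : 8 * c1 ^+ 3 * h ^+ 3 = (2 * c1 * h) ^+ 3 by ring.
  have ch0 : 0 < 2 * c1 * h by apply: mulr_gt0 => //; exact: mulr_gt0.
  by apply: lerXn2r => //; rewrite nnegrE ltW.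
rewrite ler_pdivrMr ?exprn_gt0// mulrAC ler_pdivlMr ?exprn_gt0//.
by move: h3; move: (sg ^+ 3) (c1 ^+ 3) (h ^+ 3) => u v w; lra.
Qed.

Context {d : measure_display} {T : measurableType d} (P : probability T R).

Lemma integral_probability_cst (c : \bar R) : (\int[P]_w c = c)%E.
Proof. by rewrite (integral_cst P measurableT) /= probability_setT mule1. Qed.

Variable B : T -> R -> R.
Hypothesis brB : standard_brownian P B.

Lemma measurable_variation_bound l r s a b c1 k : 0 < s k -> s k < s (k + 1) ->
  measurable_fun [set: T] (fun w => variation_bound l r s a b c1 (B w) k).
Proof.
move=> s0 sk; apply: emeasurable_funD => //; apply: emeasurable_funD => //.
apply: emeasurable_funM => //; exact: (measurable_brownian_energy brB (ltW s0) sk).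
Qed.

(** With [sg] the square root of the length, the mean energy has order [sg ^ 4] and its coefficient
    order [sg ^ -3]. What remains is linear in [sg], hence summable. *)
Lemma expected_variation_bound_le l r s a b c1 k : 0 < s k -> s k < s (k + 1) -> 0 < c1 ->
  (\int[P]_w variation_bound l r s a b c1 (B w) k <=
   dk l r s a b k + (dk' l r s a b k + dk' l r s a b k) +
   (c1 + 32 * c1 ^+ 3 * (125 * 16 * 30 * (128 / 3)))%:E *
     (Num.sqrt (s (k + 1)%R - s k))%:E)%E.
Proof.
move=> s0 sk c10.
rewrite /variation_bound; set D := (dk l r s a b k + _)%E.
set sg := Num.sqrt (s (k + 1) - s k).
have D0 : (0 <= D)%E by rewrite !adde_ge0// ?dk_ge0// dk'_ge0.
clearbody D.
have sg0 : 0 < sg by rewrite sqrtr_gt0 subr_gt0.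
have mE := measurable_brownian_energy brB (ltW s0) sk.
have E0 w := dyadic_energy_ge0 (B w) (s k) (s (k + 1)).
have k0 : (0 <= (32 * c1 ^+ 3 / sg ^+ 3)%:E)%E.
  rewrite lee_fin; apply: divr_ge0; last by apply: exprn_ge0; exact: ltW.
  by apply: mulr_ge0 => //; apply: exprn_ge0; exact: ltW.
have csg0 : (0 <= (c1 * sg)%:E)%E by rewrite lee_fin mulr_ge0// ltW.
have mkE : measurable_fun [set: T] (fun w => (32 * c1 ^+ 3 / sg ^+ 3)%:E *
    dyadic_energy (B w) (s k) (s (k + 1)%R))%E by exact: emeasurable_funM.
have kE0 w : (0 <= (32 * c1 ^+ 3 / sg ^+ 3)%:E * dyadic_energy (B w) (s k) (s (k + 1)%R))%E.
  exact: mule_ge0.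
rewrite ge0_integralD//; [|by move=> w _; exact: adde_ge0|exact: emeasurable_funD].
rewrite ge0_integralD//.
rewrite ge0_integralZl//.
rewrite !integral_probability_cst leeD2l//.
set K := 32 * c1 ^+ 3 * (_ * (128 / 3)).
have -> : ((c1 + K)%:E * sg%:E = (c1 * sg)%:E + (K * sg)%:E)%E by rewrite -EFinM mulrDl EFinD.
rewrite leeD2l//.
apply: (@le_trans _ _ ((32 * c1 ^+ 3 / sg ^+ 3)%:E *
    (125 * 16 * 30 * (128 / 3) * (s (k + 1) - s k) ^+ 2)%:E)%E).
  by apply: lee_wpmul2l => //; exact: (brownian_energy_le brB (ltW s0) sk).
rewrite -EFinM lee_fin /K.
have -> : (s (k + 1) - s k) ^+ 2 = sg ^+ 4.
  by rewrite (exprM sg 2 2) sqr_sqrtr// subr_ge0 ltW.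
by rewrite le_eqVlt; apply/orP; left; apply/eqP; field; rewrite gt_eqF.
Qed.

End ExpectedVariation.

Theorem theorem4p7 (R : realType) (d : measure_display) (T : measurableType d)
  (P : probability T R) (B : T -> R -> R)
  (l r : R -> \bar R) (x : R) (W : T -> R -> R) (tau : R)
  (s a b : int -> R) (c1 : R) :
  standard_brownian P B ->
  cadlag l -> (forall t, 0 <= t -> l t != +oo%E) ->
  cadlag r -> (forall t, 0 <= t -> r t != -oo%E) ->
  (forall t, 0 <= t -> (l t <= r t)%E) ->
  (forall w, exists eta, ESP l r (fun t => x + B w t) (W w) eta) ->
  collision_set l r !=set0 -> tau = inf (collision_set l r) -> 0 < tau ->
  (forall k, s k < s (k + 1)) ->
  s (- (n%:Z)) @[n --> \oo] --> 0 ->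
  s (n%:Z) @[n --> \oo] --> tau ->
  0 < c1 ->
  (forall k t y, s k < t -> t < s (k + 1) -> a k < y -> y < b k ->
     (l t < y%:E)%E /\ (y%:E < r t)%E) ->
  (forall k, c1^-1 * Num.sqrt (s (k + 1) - s k) < b k - a k /\
             b k - a k < c1 * Num.sqrt (s (k + 1) - s k)) ->
  (\esum_(k in [set: int]) (Num.sqrt (s (k + 1) - s k))%:E < +oo)%E ->
  (\esum_(k in [set: int]) dk l r s a b k < +oo)%E ->
  (\esum_(k in [set: int]) dk' l r s a b k < +oo)%E ->
  measurable_fun [set: T]
    (fun w => total_variation 0 tau (fun t => W w t - x - B w t) : \bar R) /\
  (\int[P]_w total_variation 0%R tau (fun t => (W w t - x - B w t)%R) < +oo)%E.
Proof.
move=> brB lc _ rc _ _ HW _ _ tau0 s_lt s0 st c10 box ab fsg fdk fdk'.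
(* The chosen [eta] coincides with [W - x - B] at all nonnegative times; its measurability in [w]
   follows from that of [x + B]. *)
have [eta H] := choice HW.
have [_ Bc mB _ _] := brB.
have pc w : {within [set t : R | 0 <= t], continuous (fun t => x + B w t)}.
  apply/subspace_continuousP => u u0; move/subspace_continuousP : (Bc w) => /(_ _ u0) h.
  by apply: cvgD => //; exact: cvg_cst.
have mpsi u : 0 <= u -> measurable_fun [set: T] (fun w => x + B w u).
  by move=> u0; apply: measurable_funD => //; exact: mB.
have YE w : total_variation 0 tau (fun t => W w t - x - B w t) = total_variation 0 tau (eta w).
  apply: eq_total_variation => t t0 _; have [_ _ E1 _ _] := H w.
  by have [-> _] := E1 t t0; ring.
have mTV : measurable_fun [set: T] (fun w => total_variation 0 tau (eta w) : \bar R).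
  exact: (measurable_ESP_total_variation H).
have sk0 k : 0 < s k by exact: int_seq_gt0.
have skt k : s k < tau by exact: int_seq_lt_lim.
split; first by rewrite (funext YE).
rewrite (eq_integral (fun w => total_variation 0 tau (eta w))) => [|w _]; last exact: YE.
(* The bound must not depend on the path. All paths satisfy [|W w (s k) - midpt a b k| <= D] with
   [D] the sum of the [dk], so along [s] they stay within [2 * D] of one reference path [w0], which
   eventually exceeds its left limit at [tau] by at most 1 in absolute value. *)
have [J J0 hJ] : exists2 J, 0 <= J &
    forall w, `|eta w tau - (leftlim (W w) tau - (x + B w tau))| <= J.
  have [[w0 _]|noT] := pselect (exists w0 : T, True); last first.
    by exists 0 => // w; case: noT; exists w.
  pose D := fine (\esum_(k in [set: int]) dk l r s a b k)%E.
  have dkD k : (dk l r s a b k <= D%:E)%E.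
    rewrite /D fineK; last first.
      by rewrite ge0_fin_numE// esum_ge0// => i _; exact: dk_ge0.
    apply: esum_ge; exists [set k]; first by split => //; exact: finite_set1.
    by rewrite fsbig_set1.
  have near_m w k : `|W w (s k) - midpt a b k| <= D.
    rewrite -lee_fin; apply: le_trans (dkD k); have [_ _ E1 _ _] := H w.
    have [_ /andP[p1 p2]] := E1 _ (ltW (sk0 k)).
    exact: (@lee_abs_between _ _ _ (W w (s k))%:E).
  have cW w : W w (s n%:Z) @[n --> \oo] --> leftlim (W w) tau.
    have [[_ pl] _ _ _ _] := H w.
    by move/cvg_at_leftP : (pl _ tau0); apply.
  pose Mb := `|leftlim (W w0) tau| + 1 + D + D.
  have D0 : 0 <= D by exact: le_trans (near_m w0 0).
  exists (`|fine (l tau)| + `|fine (r tau)| + Mb).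
    by rewrite !addr_ge0.
  move=> w; apply: (ESP_jump_le (s := fun n => s n%:Z) (H w) (pc w)) => //.
  have hlt : `|leftlim (W w0) tau| < `|leftlim (W w0) tau| + 1 by rewrite ltrDl.
  have [N _ hN] : \forall n \near \oo, `|W w0 (s n%:Z)| <= `|leftlim (W w0) tau| + 1.
    exact: cvgr_norm_le (cW w0) _ hlt.
  exists N => // n /hN /= hn.
  have h1 := near_m w n; have h2 := near_m w0 n.
  have -> : W w (s n) = (W w (s n) - midpt a b n) - (W w0 (s n) - midpt a b n) + W w0 (s n) by ring.
  apply: le_trans (ler_normD _ _) _.
  by have := ler_normB (W w (s n) - midpt a b n) (W w0 (s n) - midpt a b n); rewrite /Mb; lra.
pose G k w := variation_bound l r s a b c1 (B w) k.
have G0 k w : (0 <= G k w)%E by apply: variation_bound_ge0.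
have mG k : measurable_fun [set: T] (G k).
  by apply: (measurable_variation_bound brB); [exact: sk0|exact: s_lt].
have TVG w : (total_variation 0 tau (eta w) <=
    \sum_(0 <= n <oo) (G n%:Z w + G (- n.+1%:Z)%R w) + J%:E)%E.
  have [[_ _] [er _] _ _ _] := H w.
  have TVk k : (total_variation (s k) (s (k + 1)%R) (eta w) <= G k w)%E.
    have [ab1 ab2] := ab k.
    have := ESP_variation_bound (H w) lc rc (pc w) (sk0 k) (s_lt k) c10 (box k) ab1 ab2.
    by rewrite /variation_bound dyadic_energy_addl.
  apply: le_trans (total_variation_two_sided s_lt s0 st (fun k => G0 k w) TVk (er 0 (lexx 0))
    (ESP_eta_cvg_left (H w) (pc w) tau0)) _.
  by rewrite leeD2l// lee_fin.
have mGG n : measurable_fun [set: T] (fun w => G n%:Z w + G (- n.+1%:Z)%R w)%E.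
  exact: emeasurable_funD.
have GG0 n w : (0 <= G n%:Z w + G (- n.+1%:Z)%R w)%E by exact: adde_ge0.
have mS : measurable_fun [set: T] (fun w => \sum_(0 <= n <oo) (G n%:Z w + G (- n.+1%:Z)%R w))%E.
  by apply: ge0_emeasurable_sum => n *; [exact: GG0|exact: mGG].
have S0 w : (0 <= \sum_(0 <= n <oo) (G n%:Z w + G (- n.+1%:Z)%R w))%E.
  by apply: nneseries_ge0 => n _ _.
apply: le_lt_trans (ge0_le_integral _ _ _ mTV _ (fun w _ => TVG w)) _ => //.
- by move=> w _; apply: total_variation_ge0; exact: ltW.
- by apply: emeasurable_funD.
rewrite ge0_integralD// integral_nneseries// integral_probability_cst.
apply: lte_add_pinfty; last by rewrite ltry.
set c := c1 + 32 * c1 ^+ 3 * (125 * 16 * 30 * (128 / 3)).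
have cc0 : 0 <= c.
  apply: addr_ge0; first exact: ltW.
  by apply: mulr_ge0; [apply: mulr_ge0 => //; apply: exprn_ge0; exact: ltW|lra].
pose sg k : \bar R := (Num.sqrt (s (k + 1) - s k))%:E.
have sg0 k : (0 <= sg k)%E by rewrite lee_fin sqrtr_ge0.
have d0 k := dk_ge0 l r s a b k.
have d'0 k := dk'_ge0 l r s a b k.
have := @nneseries_lin_lty R
  (fun n => dk l r s a b n%:Z + dk l r s a b (- n.+1%:Z)%R)%E
  (fun n => dk' l r s a b n%:Z + dk' l r s a b (- n.+1%:Z)%R)%E
  (fun n => sg n%:Z + sg (- n.+1%:Z)%R)%E c.
move=> /(_ (fun n => adde_ge0 (d0 _) (d0 _)) (fun n => adde_ge0 (d'0 _) (d'0 _))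
   (fun n => adde_ge0 (sg0 _) (sg0 _)) cc0 (nneseries_int_lty d0 fdk)
   (nneseries_int_lty d'0 fdk') (nneseries_int_lty sg0 fsg)).
apply: le_lt_trans; apply: lee_nneseries => [n _ _|n _]; first by apply: integral_ge0 => w _; exact: GG0.
rewrite ge0_integralD//.
apply: le_trans (leeD (expected_variation_bound_le brB _ _ _ _ (sk0 _) (s_lt _) c10)
  (expected_variation_bound_le brB _ _ _ _ (sk0 _) (s_lt _) c10)) _.
rewrite -/c -/(sg _) -/(sg _) ge0_muleDr//.
rewrite le_eqVlt; apply/orP; left; apply/eqP.
by rewrite addeACA; congr (_ + _)%E; rewrite addeACA; congr (_ + _)%E; rewrite addeACA.
Qed.
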